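(* Assume $y$ is $q$-full. For every $n\ge1$ there is a unique rotational enriched permutation $\Sigma_n$ of $J_1$ of size $n$ minimizing $v(\sigma,\Psi^\circ)$ among all rotational enriched permutations $\sigma$ of $J_1$ of size $n$. Moreover, setting $\Sigma_0$ to be the empty permutation and $\nu_n=v(\Sigma_n,\Psi^\circ)-v(\Sigma_{n-1},\Psi^\circ)$, one has $\nu_{n+1}>\nu_n$ for all $n\ge1$.
   Context: Let $q=p^b$, $p$ prime. Write $y\in\mathbb{Z}_p$ as $y=\sum_{i=1}^b p^{i-1}y_i$, $y_i=\sum_{j\ge0}y_{i,j}q^j$ with $0\le y_{i,j}<p$; $y$ is $q$-full if no $y_i$ is a non-negative integer. Indices $i$ are taken in $\mathbb{Z}/b\mathbb{Z}$. With indeterminates $\pi,\theta$, let $\beta_i=\prod_{j\ge0}(1-\pi^{q^jp^{i-1}}\theta)^{y_{i,j}}\in\mathbb{F}_p[[\pi]][[\theta]]$, $\beta_i=\sum_{n\ge0}a_{i,n}\theta^n$, and $a_{i,n}=0$ for $n<0$. Let $J_1=\mathbb{Z}/b\mathbb{Z}\times\mathbb{Z}_{>0}$; for $k=(i,m)$ write $\mathbf{i}(k)=i$, $|k|=m$. Let $\Psi^\circ$ be the $J_1\times J_1$ matrix with $\Psi^\circ_{k_1,k_2}=a_{\mathbf{i}(k_1),\,p|k_1|-|k_2|}$ if $\mathbf{i}(k_2)=\mathbf{i}(k_1)-1$ and $0$ otherwise. An enriched permutation is a pair $(S,\sigma)$ with $S\subset J_1$ finite and $\sigma$ a permutation of $S$;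 it is rotational if $\mathbf{i}(\sigma(k))=\mathbf{i}(k)-1$ for all $k\in S$, in which case its size is $|S|/b$. Set $v(\sigma,\Psi^\circ)=\sum_{k\in S}v_\pi(\Psi^\circ_{k,\sigma(k)})\in\mathbb{Z}_{\ge0}\cup\{\infty\}$, with $v_\pi$ the $\pi$-adic valuation. *)

(* Defs.v *)
From HB Require Import structures.
From mathcomp Require Import all_boot all_order all_algebra.
From mathcomp Require Import finmap.
From Stdlib Require Import ClassicalEpsilon.

Set Implicit Arguments.
Unset Strict Implicit.
Unset Printing Implicit Defensive.

Import Order.TTheory GRing.Theory Num.Theory.
Local Open Scope fset_scope.
Local Open Scope ring_scope.

(* Conventions:
   - y in Z_p is given by its p-adic digit sequence d : nat -> nat (d k < p),
     y = sum_k d k p^k.  Hence y_{i,j} = d ((i-1) + b*j) for i = 1..b.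
   - The class i in Z/bZ (paper index i in {1,..,b}) is represented by
     i0 : 'I_b with i0 = i - 1; thus "i(k2) = i(k1) - 1 in Z/bZ" becomes
     (i0(k2) + 1) mod b = i0(k1).
   - An element of J_1 is a pair (i0, m) : 'I_b * nat with 0 < m.
   - F_p[[pi]] is represented by coefficient functions nat -> 'F_p. *)

Definition ydig (b : nat) (d : nat -> nat) (i : 'I_b) (j : nat) : nat :=
  d (i + b * j)%N.

(* q-full: no y_i is a non-negative integer, i.e. each y_i has infinitely
   many nonzero q-adic digits. *)
Definition qfull (b : nat) (d : nat -> nat) : Prop :=
  forall (i : 'I_b) (N : nat), exists j : nat, (N <= j)%N /\ ydig d i j <> 0%N.

(* Partial product prod_{j <= M} (1 - pi^{q^j p^{i-1}} theta)^{y_{i,j}}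
   in F_p[pi][theta]  (outer variable: theta, inner variable: pi). *)
Definition beta_trunc (p b : nat) (d : nat -> nat) (i : 'I_b) (M : nat)
  : {poly {poly 'F_p}} :=
  \prod_(j < M.+1)
     (1 - (('X^((p ^ b) ^ j * p ^ i)%N : {poly 'F_p})%:P) * 'X) ^+ ydig d i j.

(* a_{i,n} in F_p[[pi]]: the coefficient of pi^m theta^n of the infinite
   product beta_i equals that of the partial product over j <= m (the
   factors with j > m are 1 modulo pi^{m+1} since q^j > m). *)
Definition acoef (p b : nat) (d : nat -> nat) (i : 'I_b) (n : nat)
  : nat -> 'F_p :=
  fun m => ((beta_trunc p d i m)`_n)`_m.

(* Psi°_{k1,k2}; a_{i,n} = 0 for n < 0. *)
Definition Psi (p b : nat) (d : nat -> nat) (k1 k2 : 'I_b * nat)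
  : nat -> 'F_p :=
  if (((k2.1 + 1) %% b)%N == k1.1) && (k2.2 <= p * k1.2)%N
  then acoef p d k1.1 (p * k1.2 - k2.2)%N
  else fun _ => 0.

(* pi-adic valuation in Z_{>=0} u {oo}; None stands for oo. *)
Definition vpi (F : nzRingType) (f : nat -> F) : option nat :=
  match excluded_middle_informative (exists m, f m != 0) with
  | left H => Some (@ex_minn (fun m => f m != 0) H)
  | right _ => None
  end.

Definition oadd (x y : option nat) : option nat :=
  match x, y with
  | Some a, Some c => Some (a + c)%N
  | _, _ => None
  end.

Definition ole (x y : option nat) : bool :=
  match x, y with
  | _, None => true
  | None, Some _ => false
  | Some a, Some c => (a <= c)%N
  end.

(* (S, sigma) is a rotational enriched permutation of J_1: S a finite subset
   of J_1 and sigma a permutation of S (sigma is only relevant on S), with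
   i(sigma k) = i(k) - 1. *)
Definition rot_eperm (b : nat) (S : {fset ('I_b * nat)})
  (sigma : 'I_b * nat -> 'I_b * nat) : Prop :=
  [/\ forall k, k \in S -> (0 < k.2)%N,
      forall k, k \in S -> sigma k \in S,
      {in S &, injective sigma} &
      forall k, k \in S -> (((sigma k).1 + 1) %% b)%N = k.1].

Definition esize (b : nat) (S : {fset ('I_b * nat)}) : nat := (#|` S| %/ b)%N.

Definition vsig (p b : nat) (d : nat -> nat) (S : {fset ('I_b * nat)})
  (sigma : 'I_b * nat -> 'I_b * nat) : option nat :=
  \big[oadd/Some 0%N]_(k <- S) vpi (Psi p d k (sigma k)).

Definition is_minimizer (p b : nat) (d : nat -> nat) (n : nat)
  (S : {fset ('I_b * nat)}) (sigma : 'I_b * nat -> 'I_b * nat) : Prop :=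
  [/\ rot_eperm S sigma, esize S = n &
      forall (S' : {fset ('I_b * nat)}) (sigma' : 'I_b * nat -> 'I_b * nat),
        rot_eperm S' sigma' -> esize S' = n ->
        ole (vsig p d S sigma) (vsig p d S' sigma')].

(* Main.v *)
(* Let lambda_i(0) <= lambda_i(1) <= ... list the exponents q^j p^{i-1}, each
   repeated y_{i,j} times, and let V_i(n) be the sum of the first n of them; then
   v_pi(a_{i,n}) = V_i(n).  Every value is repeated at most p - 1 times, so V_i is
   convex, and strictly so across gaps of p; hence a minimizing permutation is
   increasing on each class.  It is thus a chain s_1 < ... < s_n of positive
   vectors (strict in every coordinate) of cost sum_t C(s_t), where
   C(s) = sum_i V_i(p s_i - s_{i-1}) is submodular.

   Uniqueness goes from the top vector down.  Suppose h <> s_n minimizes C among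
   the vectors between (n, ..., n) and s_n.  The displacement
   E = s_n - h splits into irreducible pieces along which C is superadditive; each
   removes at most one chip (one summand lambda_i(t)) and, by comparison of base-p
   digits, must add a chip at least p times larger than any top chip of h in the
   classes it passes through.  So C(s_n) - C(h) is large, whereas pushing the lower
   s_t below h - (n - t) costs little, because the chips concerned are smaller by
   a factor q^{n-t}: the chain was not optimal.

   Finally, for optimal chains s of length n+1 and r of length n-1, the chains
   s_t \/ r_{t-1} and s_{t+1} /\ r_t both have length n and total cost at most that
   of s and r, which with uniqueness gives the strict growth of nu_n. *)

Require Import Defs.
From HB Require Import structures.
From mathcomp Require Import all_boot all_order all_algebra.
From mathcomp Require Import finmap zify.
From Stdlib Require Import Classical ClassicalEpsilon.

Set Implicit Arguments.
Unset Strict Implicit.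
Unset Printing Implicit Defensive.

Import GRing.Theory.

(** * The cyclic index set *)

Section CyclicPredecessor.

Lemma val_iter_ordS b k (a : 'I_b) : val (iter k (@ordS b) a) = (a + k) %% b.
Proof.
elim: k => [|k IHk]; first by rewrite addn0 modn_small.
by rewrite iterS /= IHk -addn1 modnDml addn1 addnS.
Qed.

Lemma iter_ord_predK b k : cancel (iter k (@ord_pred b)) (iter k (@ordS b)).
Proof. by elim: k => [|k IHk] a //; rewrite iterSr iterS ord_predK IHk. Qed.

Lemma ord_pred_mod b (a i : 'I_b) : ((a + 1) %% b = i :> nat) <-> a = ord_pred i.
Proof.
rewrite addn1; split=> [e|->]; last by have := ord_predK i => /(congr1 val).
by rewrite -(ordSK a); congr ord_pred; apply: val_inj.
Qed.

Lemma iter_ord_pred_inj b (a : 'I_b) k k' : k < b -> k' < b ->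
  iter k (@ord_pred b) a = iter k' (@ord_pred b) a -> k = k'.
Proof.
move=> kb k'b e; set x := iter k _ a in e.
have e1 : a = iter k (@ordS b) x by rewrite iter_ord_predK.
have e2 : a = iter k' (@ordS b) x by rewrite e iter_ord_predK.
have /eqP : (x + k) %% b = (x + k') %% b by rewrite -!val_iter_ordS -e1 -e2.
by rewrite eqn_modDl !modn_small // => /eqP.
Qed.

Lemma iter_ord_pred_bij b (a : 'I_b) :
  injective (fun k : 'I_b => iter k (@ord_pred b) a).
Proof. by move=> k k' /iter_ord_pred_inj e; apply/val_inj/e. Qed.

Lemma iter_ord_pred_surj b (a j : 'I_b) :
  exists2 k, k < b & j = iter k (@ord_pred b) a.
Proof.
have [g _ gK] := injF_bij (@iter_ord_pred_bij b a).
by exists (g j); rewrite ?ltn_ord ?gK.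
Qed.

Lemma sum_ord_pred b (F : 'I_b -> nat) : \sum_i F (ord_pred i) = \sum_i F i.
Proof. by rewrite [RHS](reindex_inj (@ord_pred_inj b)). Qed.

(** Going once round the cycle returns to the start, so a function that never decreases along it
    cannot increase either. *)
Lemma ord_pred_const b (f : 'I_b -> nat) :
  (forall i, f i <= f (ord_pred i)) -> forall i j, f i = f j.
Proof.
move=> fP; suff le i j : f i <= f j by move=> i j; apply/eqP; rewrite eqn_leq !le.
have [k _ ->] := iter_ord_pred_surj i j.
by elim: k => //= k IHk; apply: leq_trans IHk _.
Qed.

Lemma sum_expn_lt p n : 1 < p -> \sum_(k < n) p ^ k < p ^ n.
Proof.
move=> p1; elim: n => [|n IHn]; first by rewrite big_ord0.
rewrite big_ord_recr expnS /=; apply: (@leq_trans (2 * p ^ n)).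
  by rewrite mul2n -addnn -addSn leq_add2r.
by rewrite leq_mul2r p1 orbT.
Qed.

(** Walking back from [ord_pred B] meets all classes without using the step at [B], so the values
    are at most 1, p, ..., p^(b-1). *)
Lemma sum_geom_lt p b (E : 'I_b -> nat) (B : 'I_b) : 1 < p ->
  (forall i, i != B -> E (ord_pred i) <= p * E i) -> E (ord_pred B) <= 1 ->
  \sum_i E i < p ^ b.
Proof.
move=> p1 EP EB; set a := ord_pred B.
have bnd k : k < b -> E (iter k (@ord_pred b) a) <= p ^ k.
  elim: k => [|k IHk] kb //=; rewrite expnS.
  apply: leq_trans (EP _ _) _; last by rewrite leq_mul2l IHk ?orbT // ltnW.
  apply/eqP; rewrite -[iter k _ a]iterSr => e.
  by have := @iter_ord_pred_inj _ B k.+1 0 kb (leq_ltn_trans (leq0n _) kb) e.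
rewrite (reindex_inj (@iter_ord_pred_bij b a)) /=.
apply: (@leq_ltn_trans (\sum_(k < b) p ^ k)).
  by apply: leq_sum => k _; apply: bnd.
exact: sum_expn_lt.
Qed.

End CyclicPredecessor.

(** * Greatest vectors below a cap *)

Section Greatest.
Variable b : nat.
Local Notation vec := ('I_b -> nat).

(** While g is not greatest, joining it with a vector it fails to dominate raises its coordinate
    sum, which [F] bounds. *)
Lemma greatest_vec (P : vec -> Prop) (F : vec) :
    (exists g, P g) -> (forall g, P g -> forall i, g i <= F i) ->
    (forall g g', P g -> P g' -> P (fun i => maxn (g i) (g' i))) ->
  exists2 g, P g & forall g', P g' -> forall i, g' i <= g i.
Proof.
move=> [g0 Pg0] bnd join.
suff: forall k g, P g -> \sum_i F i - \sum_i g i <= k ->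
    exists2 g, P g & forall g', P g' -> forall i, g' i <= g i.
  by move=> /(_ _ g0 Pg0 (leqnn _)).
elim=> [|k IHk] g Pg gk; have [|ng] :=
    classic (forall g', P g' -> forall i, g' i <= g i); try by exists g.
all: have [g' ng'] := not_all_ex_not _ _ ng.
all: have [Pg' /not_all_ex_not[i /negP]] := imply_to_and _ _ ng'.
all: rewrite -ltnNge => lt_i; pose G j := maxn (g j) (g' j).
all: have PG : P G by apply: join.
all: have ltG : \sum_j g j < \sum_j G j.
1,3: rewrite (bigD1 i) //= [X in _ < X](bigD1 i) //= -addSn leq_add //.
1,3: by rewrite /G leq_max lt_i orbT.
1,2: by apply: leq_sum => j _; rewrite leq_maxl.
all: have leF : \sum_j G j <= \sum_j F j by apply: leq_sum => j _; apply: bnd.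
- by exfalso; lia.
- by apply: (IHk G PG); lia.
Qed.

(** The third clause is a tightness property: if neither the cap nor the constraint at i were an
    equality, coordinate [ord_pred i] could be raised by one. *)
Lemma greatest_feasible p (X : pred 'I_b) (F : vec) :
  exists g : vec,
    [/\ forall i, g i <= F i,
        forall i, X i -> g (ord_pred i) <= p * g i,
        forall i, g (ord_pred i) = F (ord_pred i)
                  \/ X i /\ g (ord_pred i) = p * g i
      & forall g', (forall i, g' i <= F i) ->
          (forall i, X i -> g' (ord_pred i) <= p * g' i) ->
          forall i, g' i <= g i].
Proof.
pose P (g : vec) := (forall i, g i <= F i) /\
  (forall i, X i -> g (ord_pred i) <= p * g i).
have [|||g [gF gX] gmax] := @greatest_vec P F.
- by exists (fun=> 0); split.
- by move=> g [].
- move=> g g' [gF gX] [g'F g'X]; split=> [i|i Xi]; first by rewrite geq_max gF g'F.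
  by rewrite maxnMr geq_max !leq_max gX //= g'X // orbT.
exists g; split=> // [i|g' g'F g'X i]; last exact: gmax.
apply: NNPP => /not_or_and[ne nt].
have lt_i : g (ord_pred i) < F (ord_pred i).
  by rewrite ltn_neqAle gF andbT; apply/eqP.
pose G j := g j + (j == ord_pred i).
have PG : P G.
  split=> [j|j Xj]; rewrite /G; first by case: eqP => [->|_]; rewrite ?addn1 ?addn0.
  have [e|_] := eqVneq; last by rewrite addn0 mulnDr (leq_trans (gX j Xj)) ?leq_addr.
  move/ord_pred_inj: e => e; rewrite {j}e in Xj *.
  rewrite addn1 mulnDr (leq_trans _ (leq_addr _ _)) // ltn_neqAle gX // andbT.
  by apply/eqP=> e; apply: nt.
by have := gmax G PG (ord_pred i); rewrite /G eqxx addn1 ltnn.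
Qed.

End Greatest.

(** * Convex costs *)

Section Weights.
Variables (p b : nat).
Variable l : 'I_b -> nat -> nat.

Definition wsum (i : 'I_b) (n : nat) : nat := \sum_(t < n) l i t.

Definition feasible (s : 'I_b -> nat) := forall i, s (ord_pred i) <= p * s i.

(* Truncated subtraction: this is p s_i - s_{i-1} only for [feasible] vectors. *)
Definition chips (s : 'I_b -> nat) (i : 'I_b) : nat := p * s i - s (ord_pred i).

Definition vcost (s : 'I_b -> nat) : nat := \sum_i wsum i (chips s i).

(* The last clause holds because a sum of distinct digits' contributions below
   position x is less than p^x. *)
Definition chip_weights : Prop :=
  [/\ forall i t, 0 < l i t,
      forall i t t', t <= t' -> l i t <= l i t',
      forall i t, p ^ b * l i t <= l i (t + p.-1)
    & forall (B : 'I_b) x (K : 'I_b -> nat),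
        l B x <= \sum_(i | i != B) wsum i (K i) ->
        exists i, [/\ i != B, 0 < K i & 2 * l B x <= l i (K i).-1]].

Hypothesis p_gt1 : 1 < p.
Hypothesis lP : chip_weights.

Let l_gt0 i t : 0 < l i t. Proof. by case: lP. Qed.
Let l_homo i t t' : t <= t' -> l i t <= l i t'. Proof. by case: lP => _ + _ _; apply. Qed.
Let l_scale i t : p ^ b * l i t <= l i (t + p.-1). Proof. by case: lP. Qed.

Lemma wsumD i m k : wsum i (m + k) = wsum i m + \sum_(t < k) l i (m + t).
Proof. by rewrite /wsum big_split_ord. Qed.

Lemma wsumS i m : wsum i m.+1 = wsum i m + l i m.
Proof. by rewrite /wsum big_ord_recr. Qed.

Lemma wsum_homo i m n : m <= n -> wsum i m <= wsum i n.
Proof. by move=> /subnKC <-; rewrite wsumD leq_addr. Qed.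

Lemma wsum_upper i m n : wsum i n <= wsum i m + (n - m) * l i n.-1.
Proof.
have [mn|nm] := leqP m n; last exact: leq_trans (wsum_homo i (ltnW nm)) (leq_addr _ _).
rewrite -{1}(subnKC mn) wsumD leq_add2l -[X in X * _]card_ord -sum_nat_const.
by apply: leq_sum => t _; apply: l_homo; have := ltn_ord t; lia.
Qed.

Lemma wsum_lower i m n : m < n -> wsum i m + l i n.-1 <= wsum i n.
Proof. by case: n => // n mn; rewrite wsumS /= leq_add2r wsum_homo. Qed.

Lemma wsum_convex i lo m1 m2 hi : lo <= m1 -> lo <= m2 -> lo + hi = m1 + m2 ->
  wsum i m1 + wsum i m2 <= wsum i lo + wsum i hi.
Proof.
move=> /subnKC <- lom e; have -> : hi = m2 + (m1 - lo) by lia.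
rewrite !wsumD addnAC -!addnA !leq_add2l; apply: leq_sum => t _.
by apply: l_homo; rewrite leq_add2r.
Qed.

(** The last summands are at least p - 1 positions apart, and across such a gap the weight grows by
    the factor p^b > 1. *)
Lemma wsum_convex_strict i lo m1 m2 hi :
  lo < m1 -> lo + p.-1 <= m2 -> lo + hi = m1 + m2 ->
  wsum i m1 + wsum i m2 < wsum i lo + wsum i hi.
Proof.
move=> lom1 lom e; have -> : hi = m2 + (m1 - lo) by lia.
rewrite -{1}(subnKC (ltnW lom1)) !wsumD addnAC -!addnA !ltn_add2l.
have : 0 < m1 - lo by lia.
case: (m1 - lo) => // k _; rewrite !big_ord_recr /= -addnS leq_add //.
  by apply: leq_sum => t _; apply: l_homo; lia.
apply: leq_trans (_ : l i (lo + k + p.-1) <= _); last by apply: l_homo; lia.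
apply: leq_trans (l_scale _ _); rewrite -[X in X < _]mul1n ltn_pmul2r //.
by rewrite -[1](expn0 p) ltn_exp2l //; case: (b) i => [[]|].
Qed.

Lemma vcost_ext s s' : s =1 s' -> vcost s = vcost s'.
Proof. by move=> e; apply: eq_bigr => i _; rewrite /chips !e. Qed.

Lemma feasible_max s s' : feasible s -> feasible s' ->
  feasible (fun i => maxn (s i) (s' i)).
Proof. by move=> f f' i; rewrite maxnMr geq_max !leq_max f f' orbT. Qed.

Lemma feasible_min s s' : feasible s -> feasible s' ->
  feasible (fun i => minn (s i) (s' i)).
Proof. by move=> f f' i; rewrite minnMr leq_min !geq_min f f' orbT. Qed.

(** If the vectors compare the same way at i and at [ord_pred i], join and meet only permute the
    chip counts of class i. If they compare oppositely, the new counts lie between the old ones with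
    the same sum, and convexity applies. *)
Lemma vcost_submod s s' : feasible s -> feasible s' ->
  vcost (fun i => maxn (s i) (s' i)) + vcost (fun i => minn (s i) (s' i))
  <= vcost s + vcost s'.
Proof.
move=> f f'; rewrite /vcost -!big_split; apply: leq_sum => i _ /=.
rewrite /chips; move: (f i) (f' i).
rewrite maxnMr minnMr; move: (p * s i) (p * s' i) => x x'.
move: (s (ord_pred i)) (s' (ord_pred i)) => y y' h h'.
have [xx|/ltnW xx] := leqP x x'; have [yy|/ltnW yy] := leqP y y'.
- by rewrite addnC.
- by apply: wsum_convex; lia.
- by rewrite [X in _ <= X]addnC; apply: wsum_convex; lia.
- by [].
Qed.

Definition conformal (E E' : 'I_b -> nat) := forall i,
  E (ord_pred i) <= p * E i /\ E' (ord_pred i) <= p * E' i \/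
  p * E i <= E (ord_pred i) /\ p * E' i <= E' (ord_pred i).

Local Notation vadd := (fun s s' : 'I_b -> nat => fun i => s i + s' i).

Lemma conformal_feasible h E E' : conformal E E' -> feasible h ->
  feasible (vadd h (vadd E E')) -> feasible (vadd h E) /\ feasible (vadd h E').
Proof.
move=> cE fh fhE; split=> i; move: (cE i) (fh i) (fhE i); rewrite !mulnDr; lia.
Qed.

(* Along conformal displacements every class gains chips for both or loses chips
   for both, so convexity of [wsum] makes the cost superadditive. *)
Lemma vcost_conformal h E E' : conformal E E' -> feasible h ->
  feasible (vadd h (vadd E E')) ->
  vcost (vadd h E) + vcost (vadd h E') <= vcost h + vcost (vadd h (vadd E E')).
Proof.
move=> cE fh fhE; have [f1 f2] := conformal_feasible cE fh fhE.
rewrite /vcost -!big_split; apply: leq_sum => i _ /=; rewrite /chips.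
move: (cE i) (fh i) (f1 i) (f2 i) (fhE i); rewrite !mulnDr => -[] [] ? ? ? ? ? ?.
  by apply: wsum_convex; lia.
by rewrite [X in _ <= X]addnC; apply: wsum_convex; lia.
Qed.

End Weights.

(** * Irreducible displacements *)

Section Irreducible.
Variables (p b : nat).
Hypothesis p_gt1 : 1 < p.

Lemma feasible_pos (E : 'I_b -> nat) :
  feasible p E -> (exists i, 0 < E i) -> forall i, 0 < E i.
Proof.
move=> fE [i0 Ei0] i; rewrite lt0n; apply/eqP => Ei.
have [k _ e] := iter_ord_pred_surj i i0; move: Ei0; rewrite e.
suff -> : E (iter k (@ord_pred b) i) = 0 by [].
elim: k {e} => //= k IHk; have := fE (iter k (@ord_pred b) i).
by rewrite IHk muln0 leqn0 => /eqP.
Qed.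

(* A conformally irreducible displacement removes at most one chip, and only
   from the class [B]. *)
Lemma irreducible_shape (E : 'I_b -> nat) :
    (exists i, 0 < E i) ->
    (forall g, (forall i, g i <= E i) -> conformal p g (fun i => E i - g i) ->
       (forall i, g i = 0) \/ (forall i, g i = E i)) ->
  exists2 B, forall i, i != B -> E (ord_pred i) <= p * E i & E (ord_pred B) = 1.
Proof.
move=> Enz irr; have [fE|/not_all_ex_not[B /negP]] := classic (feasible p E).
  have Epos := feasible_pos fE Enz.
  have [[a Ea]|no1] := classic (exists a, E a = 1).
    by exists (ordS a); [move=> i _; apply: fE | rewrite ordSK].
  have E2 i : 1 < E i.
    by rewrite ltn_neqAle Epos andbT eq_sym; apply/eqP => Ei; apply: no1; exists i.
  (* All coordinates are at least 2, so this g lies strictly between 0 and E; tightness makes it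
     conformal to E - g, against irreducibility. *)
  have [g [gF gf gt gmax]] :=
    greatest_feasible p (fun=> true) (fun i => (E i).-1).
  have g1 i : 1 <= g i.
    apply: (gmax (fun=> 1)) => [j|j _]; first by have := E2 j; lia.
    by rewrite muln1 ltnW.
  have [|i|e|e] := irr g.
  - by move=> i; have := gF i; lia.
  - left; split; first exact: gf.
    move: (fE i) (gt i) (gf i isT) (E2 i) (E2 (ord_pred i)) (gF i).
    move=> + + + + + /(leq_mul (leqnn p)).
    rewrite /= -!subn1 !mulnBr muln1.
    have: p * 1 <= p * E i by rewrite leq_mul2l Epos orbT.
    lia.
  - by case: Enz => i _; have := g1 i; rewrite e.
  - by case: Enz => i _; have := gF i; have := E2 i; rewrite e; lia.
rewrite -ltnNge => ltB.
have [[k Ek]|no0] := classic (exists k, E k = 0); last first.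
  have Epos i : 0 < E i.
    by rewrite lt0n; apply/eqP => Ei; apply: no0; exists i.
  (* Here E is positive but infeasible, so g is neither 0 nor E, and tightness again gives a
     conformal splitting. *)
  have [g [gF gf gt gmax]] := greatest_feasible p (fun=> true) E.
  have g1 i : 1 <= g i.
    by apply: (gmax (fun=> 1)) => // j _; rewrite muln1 ltnW.
  have [i|e|e] := irr g gF.
  - move: (gf i isT) (gF i) (gt i) => /[dup] gi + /(leq_mul (leqnn p)).
    by rewrite /= mulnBr; lia.
  - by have := g1 B; rewrite e.
  - by have := gf B isT; rewrite !e leqNgt ltB.
have EB : 0 < E (ord_pred B) by apply: leq_ltn_trans ltB.
(* Capping [ord_pred B] at 1 and dropping the constraint at [B] yields a g that removes a single
   chip, from class [B]; irreducibility then makes it equal to E. *)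
have [g [gF gf gt _]] := greatest_feasible p (predC1 B)
  (fun i => if i == ord_pred B then 1 else E i).
have gB1 : g (ord_pred B) = 1 by case: (gt B); rewrite /= !eqxx // => -[].
have gE i : g i <= E i by have := gF i; case: eqP => // ->; lia.
have gB0 : g B = 0.
  (* The zero at k propagates along predecessors until it reaches [B]. *)
  have [m mb e] := iter_ord_pred_surj k B.
  suff gj j : j <= m -> g (iter j (@ord_pred b) k) = 0 by rewrite e gj.
  elim: j => [|j IHj] jm; first by have := gE k; rewrite Ek leqn0 => /eqP.
  have neB : iter j (@ord_pred b) k != B.
    apply/eqP; rewrite e => /(iter_ord_pred_inj (ltn_trans jm mb) mb) ejm.
    by rewrite ejm ltnn in jm.
  by have := gf _ neB; rewrite (IHj (ltnW jm)) muln0 leqn0 => /eqP.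
have [i|e|e] := irr g gE.
- have [->|neB] := eqVneq i B.
    by right; rewrite gB0 gB1 muln0 subn0; split=> //; move: ltB; lia.
  have gti : g (ord_pred i) = E (ord_pred i) \/ g (ord_pred i) = p * g i.
    by case: (gt i) => [|[]]; [rewrite (inj_eq (@ord_pred_inj b)) (negPf neB); left | right].
  move: (gf i neB) (gE i) gti => /[dup] gi + /(leq_mul (leqnn p)).
  by rewrite /= mulnBr; lia.
- by rewrite e in gB1.
- by exists B => [i neB|]; rewrite -!e //; apply: gf.
Qed.

End Irreducible.

(** * Cost gained above a minimal vector *)

Section Descent.
Variables (p b : nat).
Variable l : 'I_b -> nat -> nat.
Hypothesis p_gt1 : 1 < p.
Hypothesis lP : chip_weights p l.

Let l_gt0 i t : 0 < l i t. Proof. by case: lP. Qed.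
Let l_homo i t t' : t <= t' -> l i t <= l i t'. Proof. by case: lP => _ + _ _; apply. Qed.
Let l_scale i t : p ^ b * l i t <= l i (t + p.-1). Proof. by case: lP. Qed.

Let l_sep B x K : l B x <= \sum_(i | i != B) wsum l i (K i) ->
  exists i, [/\ i != B, 0 < K i & 2 * l B x <= l i (K i).-1].
Proof. by case: lP => _ _ _ /(_ B x K). Qed.

Local Notation vadd := (fun s s' : 'I_b -> nat => fun i => s i + s' i).

Definition top_chip (h : 'I_b -> nat) (i : 'I_b) : nat :=
  if chips p h i is c.+1 then l i c else 0.

Definition minimal_below (h E : 'I_b -> nat) : Prop :=
  forall G : 'I_b -> nat, (forall i, G i <= E i) -> feasible p (vadd h G) ->
    vcost p l h <= vcost p l (vadd h G).

Lemma expnb_gt1 : 'I_b -> 1 < p ^ b.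
Proof. by case: (b) => [[]//|n _]; rewrite -[1](expn0 p) ltn_exp2l. Qed.

Lemma chips_vadd h E i : feasible p h -> E (ord_pred i) <= p * E i ->
  chips p (vadd h E) i = chips p h i + (p * E i - E (ord_pred i)).
Proof. by move=> fh le; have := fh i; rewrite /chips mulnDr; lia. Qed.

(* Removing the top chip of class [B] from [h] must be paid for by a chip above
   it; otherwise the base-p digits show that the cost decreases. *)
Lemma big_chip h E B : feasible p h -> minimal_below h E ->
    0 < E (ord_pred B) -> 0 < chips p h B ->
  exists2 i, E (ord_pred i) < p * E i &
    2 * top_chip h B <= l i (chips p h i + (p * E i - E (ord_pred i))).-1.
Proof.
move=> fh hmin EB hB; have q1 := expnb_gt1 B.
rewrite /top_chip; case Ec: (chips p h B) hB => [//|x] _.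
have [leE|ltE] := leqP (E (ord_pred B)) (E B).
  (* Class [B] itself gains at least p - 1 chips, enough to multiply the weight by p^b >= 2. *)
  have gain : p.-1 <= p * E B - E (ord_pred B).
    have := leq_mul (leqnn p.-1) (leq_trans EB leE).
    have: p * E B = p.-1 * E B + E B by rewrite -{1}(prednK (ltnW p_gt1)) mulSn addnC.
    lia.
  exists B; first by rewrite -subn_gt0; apply: leq_trans gain; lia.
  apply: (@leq_trans (p ^ b * l B x)); first by rewrite leq_mul2r q1 orbT.
  by rewrite Ec (leq_trans (l_scale _ _)) // l_homo //; lia.
(* Take one chip off [B]. The cap E - E_B forces g_B = 0, and since p E_B >= E_B, a class gaining
   chips under g gains at least as many under E. *)
have [g [gF gf gt _]] := greatest_feasible p (predC1 B)
  (fun i => if i == ord_pred B then 1 else E i - E B).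
have gB1 : g (ord_pred B) = 1 by case: (gt B); rewrite /= !eqxx // => -[].
have gle i : g i <= E i - E B by have := gF i; case: eqP => // ->; lia.
have gB0 : g B = 0 by have := gle B; rewrite subnn leqn0 => /eqP.
have fhg : feasible p (vadd h g).
  move=> i; rewrite mulnDr; have [->|neB] := eqVneq i B.
    by rewrite gB1 gB0 muln0 addn0 addn1; move: Ec; rewrite /chips; lia.
  by rewrite leq_add ?fh ?gf.
have gE i : g i <= E i by apply: leq_trans (gle i) (leq_subr _ _).
have := hmin g gE fhg; rewrite /vcost (bigD1 B) //= [X in _ <= X](bigD1 B) //=.
have -> : chips p (vadd h g) B = x.
  by move: Ec; rewrite /chips mulnDr gB0 gB1 muln0; lia.
rewrite Ec wsumS -addnA leq_add2l => le.
(* [K] vanishes on classes that gain nothing, so [l_sep] can only point to a class where a chip was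
   really added. *)
pose K i := if 0 < p * g i - g (ord_pred i)
  then chips p h i + (p * g i - g (ord_pred i)) else 0.
have [|i [neB]] := @l_sep B x K.
  rewrite -(leq_add2r (\sum_(i | i != B) wsum l i (chips p h i))).
  apply: leq_trans le _; rewrite -big_split; apply: leq_sum => i neB /=.
  rewrite chips_vadd ?gf // /K; case: ltnP => [_|]; first exact: leq_addr.
  by rewrite leqn0 => /eqP ->; rewrite addn0 leq_addl.
rewrite /K; case: (posnP (p * g i - g (ord_pred i))) => // d0 _ le2.
have tight : g (ord_pred i) = E (ord_pred i) - E B.
  case: (gt i); last by move=> [_ e]; move: d0; rewrite e subnn.
  by rewrite (inj_eq (@ord_pred_inj b)) (negPf neB).
have dle : p * g i - g (ord_pred i) <= p * E i - E (ord_pred i).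
  have := leq_mul (leqnn p) (gle i); rewrite mulnBr tight.
  have: 1 * E B <= p * E B by rewrite leq_mul2r (ltnW p_gt1) orbT.
  by have := gf i neB; rewrite tight; lia.
exists i; first by rewrite -subn_gt0 (leq_trans d0 dle).
by apply: leq_trans le2 (l_homo _ _); lia.
Qed.

Lemma top_chip_gt0 h i : (0 < top_chip h i) = (0 < chips p h i).
Proof. by rewrite /top_chip; case: chips => //= c; rewrite l_gt0. Qed.

(** By [big_chip], some added chip weighs at least twice the heaviest top chip among the classes
    with E_(i-1) > 0. One half pays for the chip that [B] may lose, the other is the claimed
    gain. *)
Lemma gain_irreducible h E B : feasible p h -> feasible p (vadd h E) ->
    minimal_below h E ->
    (forall i, i != B -> E (ord_pred i) <= p * E i) -> E (ord_pred B) = 1 ->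
  vcost p l h < vcost p l (vadd h E) /\
  forall i, 0 < E (ord_pred i) -> vcost p l h + top_chip h i <= vcost p l (vadd h E).
Proof.
move=> fh fhE hmin EP EB.
(* Class [B] changes by p E_B - 1 chips, so it loses one exactly when E_B = 0. *)
pose R := if E B == 0 then top_chip h B else 0.
have loss i : E (ord_pred i) < p * E i ->
    vcost p l h + l i (chips p h i + (p * E i - E (ord_pred i))).-1
    <= vcost p l (vadd h E) + R.
  set T := l i _ => gain.
  have sum1 k (x : nat) : x = \sum_(j : 'I_b) (if j == k then x else 0).
    by rewrite -big_mkcond big_pred1_eq.
  rewrite [X in _ + X <= _](sum1 i) [X in _ <= _ + X](sum1 B) -!big_split.
  apply: leq_sum => j _ /=.
  have [->|nei] := eqVneq j i.
    apply: leq_trans (leq_addr _ _); rewrite chips_vadd ?(ltnW gain) //.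
    by apply: wsum_lower => //; lia.
  rewrite addn0; have [ej|neB] := eqVneq j B; last first.
    by rewrite addn0 chips_vadd ?EP // wsum_homo // leq_addr.
  rewrite {j nei}ej /R; case: eqP => [EB0|/eqP EB0]; last first.
    by rewrite addn0 chips_vadd ?wsum_homo ?leq_addr // EB muln_gt0 (ltnW p_gt1) lt0n EB0.
  have := fhE B; rewrite /top_chip /chips !mulnDr EB0 EB muln0 addn0 addn1.
  case Ec: (p * h B - _) => [|c] lt; first by move: lt Ec; lia.
  by rewrite wsumS (_ : _ - _ = c) //; move: Ec; lia.
pose M := [arg max_(i > B | 0 < E (ord_pred i)) top_chip h i].
have [EM maxM] : 0 < E (ord_pred M) /\
    forall i, 0 < E (ord_pred i) -> top_chip h i <= top_chip h M.
  by rewrite /M; case: arg_maxnP => [|j]; rewrite ?EB.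
have RM : R <= top_chip h M by rewrite /R; case: ifP => // _; rewrite maxM ?EB.
(* If the heaviest top chip is 0 then R = 0, and a class where E is maximal gains a chip. *)
have [tM|] := posnP (top_chip h M).
  have [i gain] : exists i, E (ord_pred i) < p * E i.
    have [i _ maxE] := @arg_maxnP _ (ord_pred B) xpredT E isT.
    exists i; apply: leq_ltn_trans (maxE (ord_pred i) isT) _.
    rewrite -[X in X < _]mul1n ltn_pmul2r //.
    by apply: leq_trans (maxE (ord_pred B) isT); rewrite EB.
  have := loss i gain; move: RM; rewrite tM leqn0 => /eqP ->.
  have := l_gt0 i (chips p h i + (p * E i - E (ord_pred i))).-1.
  split; first by lia.
  by move=> j Ej; have := maxM j Ej; rewrite tM leqn0 => /eqP ->; lia.
rewrite top_chip_gt0 => cM; have [i gain le2] := big_chip fh hmin EM cM.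
have tM : 0 < top_chip h M by rewrite top_chip_gt0.
have := loss i gain; split; first by lia.
by move=> j Ej; have := maxM j Ej; lia.
Qed.

(** Induction on the total of [E]. An irreducible [E] has total below p^b, whence the factor p^b -
    1. Otherwise [E] splits conformally: the left side is additive and the cost difference
    superadditive. *)
Lemma gain h E : feasible p h -> feasible p (vadd h E) ->
    minimal_below h E -> (exists i, 0 < E i) ->
  vcost p l h < vcost p l (vadd h E) /\
  \sum_i E (ord_pred i) * top_chip h i
    <= (p ^ b).-1 * (vcost p l (vadd h E) - vcost p l h).
Proof.
move=> fh; have [n] := ubnP (\sum_i E i); elim: n E => // n IHn E lt_n fhE hmin Enz.
have [irr|] := classic (forall g, (forall i, g i <= E i) ->
    conformal p g (fun i => E i - g i) ->
    (forall i, g i = 0) \/ (forall i, g i = E i)).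
  have [B EP EB] := irreducible_shape p_gt1 Enz irr.
  have [lt le] := gain_irreducible fh fhE hmin EP EB; split=> //.
  apply: (@leq_trans (\sum_i E (ord_pred i) * (vcost p l (vadd h E) - vcost p l h))).
    apply: leq_sum => i _; have [->//|Ei] := posnP (E (ord_pred i)).
    by rewrite leq_mul2l; have := le i Ei; lia.
  rewrite -big_distrl /= sum_ord_pred leq_mul2r; apply/orP; right.
  by have := sum_geom_lt p_gt1 EP (eq_leq EB); lia.
move=> /not_all_ex_not[g ng]; have [gE ng1] := imply_to_and _ _ ng.
have [cg ng2] := imply_to_and _ _ ng1; have [nz ne] := not_or_and _ _ ng2.
pose g' i := E i - g i.
have [i0 gi0] : exists i, 0 < g i.
  by have [i /eqP] := not_all_ex_not _ _ nz; rewrite -lt0n; exists i.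
have [i1 gi1] : exists i, 0 < g' i.
  have [i /eqP] := not_all_ex_not _ _ ne; exists i.
  by have := gE i; rewrite /g'; lia.
have eE : vadd g g' =1 E by move=> i; rewrite /g' subnKC.
have fgg : feasible p (vadd h (vadd g g')) by move=> i; rewrite !eE; apply: fhE.
have [fg fg'] := conformal_feasible p_gt1 cg fh fgg.
have sumE : \sum_i E i = \sum_i g i + \sum_i g' i.
  by rewrite -big_split; apply: eq_bigr => i _; rewrite /= eE.
have pos (F : 'I_b -> nat) i : 0 < F i -> 0 < \sum_j F j.
  by move=> Fi; rewrite (bigD1 i) //= addn_gt0 Fi.
have min_sub F : (forall i, F i <= E i) -> minimal_below h F.
  by move=> FE G GF; apply: hmin => i; apply: leq_trans (GF i) (FE i).
move: lt_n; rewrite ltnS sumE => lt_n.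
have ltg : \sum_i g i < n.
  by apply: leq_trans lt_n; rewrite -addn1 leq_add2l; apply: pos gi1.
have ltg' : \sum_i g' i < n.
  by apply: leq_trans lt_n; rewrite -add1n leq_add2r; apply: pos gi0.
have [lt le] := IHn g ltg fg (min_sub g gE) (ex_intro _ i0 gi0).
have [lt' le'] := IHn g' ltg' fg' (min_sub g' (fun i => leq_subr _ _)) (ex_intro _ i1 gi1).
have sup : vcost p l (vadd h g) + vcost p l (vadd h g') <=
    vcost p l h + vcost p l (vadd h E).
  rewrite -(@vcost_ext p _ l (vadd h (vadd g g')) (vadd h E)); last first.
    by move=> i; congr (_ + _); apply: eE.
  exact: vcost_conformal.
move: lt le lt' le' sup; move: (vcost _ _ _) (vcost _ _ _) (vcost _ _ _) (vcost _ _ _).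
move=> c cE cg1 cg2 lt le lt' le' sup; split; first by lia.
have -> : \sum_i E (ord_pred i) * top_chip h i =
    \sum_i g (ord_pred i) * top_chip h i + \sum_i g' (ord_pred i) * top_chip h i.
  by rewrite -big_split; apply: eq_bigr => i _; rewrite /= -mulnDl -[E _]eE.
apply: leq_trans (leq_add le le') _; rewrite -mulnDr leq_mul2l; apply/orP; right; lia.
Qed.

End Descent.

(** * Optimal chains *)

Lemma ex_min (T : Type) (P : T -> Prop) (f : T -> nat) :
  (exists x, P x) -> exists2 x, P x & forall y, P y -> f x <= f y.
Proof.
move=> [x0 Px0]; have [n] := ubnP (f x0); elim: n x0 Px0 => // n IHn x Px fx.
have [|nmin] := classic (forall y, P y -> f x <= f y); first by exists x.
have [y ny] := not_all_ex_not _ _ nmin; have [Py /negP] := imply_to_and _ _ ny.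
by rewrite -ltnNge => lt; apply: (IHn y Py); apply: leq_trans lt _.
Qed.

Section Chains.
Variables (p b : nat).
Variable l : 'I_b -> nat -> nat.
Hypothesis p_gt1 : 1 < p.
Hypothesis lP : chip_weights p l.

Local Notation vadd := (fun s s' : 'I_b -> nat => fun i => s i + s' i).
Local Notation q := (p ^ b).

Definition chain (n : nat) (s : nat -> 'I_b -> nat) : Prop :=
  [/\ forall t, t < n -> feasible p (s t),
      forall t i, t < n -> 0 < s t i
    & forall t i, t.+1 < n -> s t i < s t.+1 i].

Definition chain_cost (n : nat) (s : nat -> 'I_b -> nat) : nat :=
  \sum_(t < n) vcost p l (s t).

Definition bounded (B : 'I_b -> nat) (n : nat) (s : nat -> 'I_b -> nat) : Prop :=
  forall t i, t < n -> s t i <= B i.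

(** The box [B] makes induction on length possible: under a fixed top vector, the rest of an optimal
    chain is optimal in a smaller box. *)
Definition optimal_below (B : 'I_b -> nat) (n : nat) (s : nat -> 'I_b -> nat) : Prop :=
  [/\ chain n s, bounded B n s &
      forall u, chain n u -> bounded B n u -> chain_cost n s <= chain_cost n u].

Lemma chain_gt n s t i : chain n s -> t < n -> t < s t i.
Proof.
move=> [_ pos incr]; elim: t => [|t IHt] tn; first exact: pos.
exact: leq_ltn_trans (IHt (ltnW tn)) (incr _ _ tn).
Qed.

Lemma chainW n s : chain n.+1 s -> chain n s.
Proof.
by move=> [f pos incr]; split=> [t tn|t i tn|t i tn]; [apply: f|apply: pos|apply: incr];
  apply: ltnW.
Qed.

Definition extend (n : nat) (s : nat -> 'I_b -> nat) (v : 'I_b -> nat) :=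
  fun t => if t < n then s t else v.

Lemma chain_extend n s v : chain n s -> feasible p v -> (forall i, 0 < v i) ->
  (forall t i, t < n -> s t i < v i) -> chain n.+1 (extend n s v).
Proof.
move=> [f pos incr] fv vpos lt; split=> [t _|t i _|t i].
- by rewrite /extend; case: ifP => // /f.
- by rewrite /extend; case: ifP => // /pos.
- rewrite /extend ltnS => tn; rewrite tn; case: ifP => [|_]; [exact: incr | exact: lt].
Qed.

Lemma chain_cost_extend n s v :
  chain_cost n.+1 (extend n s v) = chain_cost n s + vcost p l v.
Proof.
rewrite /chain_cost big_ord_recr /extend /= ltnn; congr (_ + _).
by apply: eq_bigr => t _; rewrite ltn_ord.
Qed.

Lemma chain_costS n s : chain_cost n.+1 s = chain_cost n s + vcost p l (s n).
Proof. by rewrite /chain_cost big_ord_recr. Qed.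

Lemma chain_gap n s t i : chain n.+1 s -> t <= n -> s t i + (n - t) <= s n i.
Proof.
elim: n => [|n IHn] ch; first by rewrite leqn0 => /eqP->; rewrite addn0.
rewrite leq_eqVlt => /predU1P[->|tn]; first by rewrite subnn addn0.
by case: (ch) => _ _ /(_ n i (leqnn _)); have := IHn (chainW ch) tn; lia.
Qed.

Lemma scale_iter j i t : q ^ j * l i t <= l i (t + j * p.-1).
Proof.
elim: j t => [|j IHj] t; first by rewrite mul1n addn0.
rewrite expnSr -mulnA mulSn addnA.
by apply: leq_trans (IHj _); rewrite leq_mul2l; case: lP => _ _ -> _; rewrite orbT.
Qed.

(** Class i acquires chips only if r_(i-1) < s_(i-1), and then tightness gives r_(i-1) = h_(i-1) -
    j. So at most E_(i-1) chips are new, and they sit at least j(p - 1) positions below the top of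
    [h], where weights are smaller by q^j. *)
Lemma lowered_cost h E s r j :
    feasible p h -> feasible p s -> feasible p r -> (forall i, j <= h i) ->
    (forall i, r i <= h i - j) ->
    (forall i, r (ord_pred i) = h (ord_pred i) - j \/ r (ord_pred i) = p * r i) ->
    (forall i, s i + j <= h i + E i) ->
  q ^ j * vcost p l (fun i => minn (s i) (r i))
  <= q ^ j * vcost p l s + \sum_i E (ord_pred i) * top_chip p l h i.
Proof.
move=> fh fs fr jh rh rt sE; rewrite !big_distrr -big_split; apply: leq_sum => i _ /=.
set u := fun i => _; have [le|lt] := leqP (chips p u i) (chips p s i).
  by apply: leq_trans (leq_addr _ _); rewrite leq_mul2l wsum_homo ?orbT.
have lt1 : p * s i - s (ord_pred i) <
    minn (p * s i) (p * r i) - minn (s (ord_pred i)) (r (ord_pred i)).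
  by move: lt; rewrite /chips /u minnMr.
have rs : r (ord_pred i) < s (ord_pred i).
  by rewrite ltnNge; apply/negP => le; move: lt1; rewrite (minn_idPl le) ltnNge; lia.
rewrite (minn_idPr (ltnW rs)) in lt1.
have r1 : r (ord_pred i) = h (ord_pred i) - j.
  by case: (rt i) => // e; move: lt1; rewrite e; lia.
have cu : chips p u i + j * p.-1 <= chips p h i.
  have := leq_mul (leqnn p) (rh i); have := leq_mul (leqnn p) (jh i).
  rewrite mulnBr /chips /u minnMr (minn_idPr (ltnW rs)) r1.
  have : p * j = j * p.-1 + j by rewrite -{1}(prednK (ltnW p_gt1)) mulSn addnC mulnC.
  by have := jh (ord_pred i); move: lt1; rewrite r1; lia.
apply: (@leq_trans (q ^ j * (wsum l i (chips p s i) +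
  (chips p u i - chips p s i) * l i (chips p u i).-1))).
  by rewrite leq_mul2l (wsum_upper p_gt1 lP) orbT.
rewrite mulnDr leq_add2l mulnCA leq_mul //.
  have := sE (ord_pred i); have := jh (ord_pred i).
  by rewrite /chips /u minnMr (minn_idPr (ltnW rs)) r1; move: lt1; rewrite r1; lia.
apply: leq_trans (scale_iter _ _ _) _; rewrite /top_chip.
case: (chips p u i) lt cu => [//|c] _; rewrite addSn.
case: (chips p h i) => [//|c']; rewrite ltnS => cc'.
by case: lP => _ + _ _; apply.
Qed.

(* If some [h] below the top vector were no more expensive, lowering the whole
   chain under [h] would save more at the top (by [gain]) than it costs further
   down, where weights are smaller by powers of [q]. *)
Lemma top_strict_min B m s v : optimal_below B m.+1 s -> feasible p v ->
    (forall i, m < v i <= s m i) -> (exists i, v i != s m i) ->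
  vcost p l (s m) < vcost p l v.
Proof.
move=> [ch bd opt] fv vm vne; rewrite ltnNge; apply/negP => lev.
pose P h := [/\ feasible p h, forall i, m < h i <= s m i & exists i, h i != s m i].
(* The cheapest candidate satisfies [minimal_below]; the excluded vector [s m] is covered by the
   assumption [lev]. *)
have [h [fh hm hne] hmin] : exists2 h, P h &
    forall v, P v -> vcost p l h <= vcost p l v.
  by apply: ex_min; exists v.
pose E i := s m i - h i.
have hE : vadd h E =1 s m by move=> i; rewrite /E subnKC //; case/andP: (hm i).
have fsm : feasible p (s m) by case: ch => f _ _; apply: f.
have fhE : feasible p (vadd h E) by move=> i; rewrite !hE; apply: fsm.
have mb : minimal_below p l h E.
  move=> G GE fG; have [[i ne]|eq] := classic (exists i, vadd h G i != s m i).
    apply: hmin; split=> //; last by exists i.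
    by move=> j; have := hE j; have := GE j; have := hm j; rewrite /=; lia.
  rewrite (@vcost_ext p _ l (vadd h G) (s m)); first by apply: leq_trans lev; apply: hmin.
  by move=> i; apply/eqP/negP => /negP ne; apply: eq; exists i.
have Enz : exists i, 0 < E i.
  by case: hne => i ne; exists i; rewrite /E subn_gt0 ltn_neqAle ne; case/andP: (hm i).
have [] := gain p_gt1 lP fh fhE mb Enz.
rewrite (@vcost_ext p _ l (vadd h E) (s m) hE); set S := \sum_i _ => lt leS.
pose rP j g := [/\ forall i, g i <= h i - j, feasible p g,
  forall i, g (ord_pred i) = h (ord_pred i) - j \/ g (ord_pred i) = p * g i
  & forall g', (forall i, g' i <= h i - j) -> feasible p g' -> forall i, g' i <= g i].
have exr j : exists g, rP j g.
  have [g [gF gf gt gmax]] := greatest_feasible p (fun=> true) (fun i => h i - j).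
  exists g; split=> // [i|i|g' ? ?]; first exact: gf; last by apply: gmax.
  by case: (gt i) => [|[]]; [left | right].
pose r j := proj1_sig (constructive_indefinite_description _ (exr j)).
have rQ j : rP j (r j) := proj2_sig (constructive_indefinite_description _ (exr j)).
(* The competing chain has h on top and pushes [s t] below the greatest feasible vector under h - (m
   - t). *)
pose u t i := minn (s t i) (r (m - t) i).
have mh i : m < h i by case/andP: (hm i).
have chu : chain m.+1 u.
  case: (ch) => f pos incr; split=> [t tm|t i tm|t i tm].
  - by apply: feasible_min; [apply: f | case: (rQ (m - t))].
  - rewrite leq_min pos //; case: (rQ (m - t)) => _ _ _ /(_ (fun=> 1)); apply.
      by move=> j; have := mh j; lia.
    by move=> j; rewrite muln1 ltnW.
  - rewrite leq_min !gtn_min incr //=; apply/orP; right.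
    have [rh fr _ _] := rQ (m - t); case: (rQ (m - t.+1)) => _ _ _.
    (* This vector is feasible and fits under the next cap, so maximality gives strict growth. *)
    move=> /(_ (fun i => (r (m - t) i).+1)); apply.
      by move=> j; have := rh j; have := mh j; lia.
    by move=> j; rewrite mulnS -add1n leq_add ?fr // ltnW.
have bdu : bounded B m.+1 u by move=> t i tm; rewrite geq_min bd.
have um : vcost p l (u m) = vcost p l h.
  apply: vcost_ext => i; rewrite /u subnn; have [rh _ _ rmax] := rQ 0.
  have -> : r 0 i = h i.
    by apply/eqP; rewrite eqn_leq rmax ?andbT // => [|j]; rewrite ?subn0 // -[h i]subn0.
  by apply/minn_idPr; case/andP: (hm i).
have := opt u chu bdu; rewrite !chain_costS um => leC.
have low t : t < m -> q ^ m * vcost p l (u t) <= q ^ m * vcost p l (s t) + q ^ t * S.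
  move=> tm; have -> : q ^ m = q ^ t * q ^ (m - t) by rewrite -expnD subnKC // ltnW.
  rewrite -!mulnA -mulnDr leq_mul2l; apply/orP; right.
  have [rh fr rt _] := rQ (m - t); apply: lowered_cost => //.
  - by case: ch => f _ _; apply: f; apply: ltnW.
  - by move=> i; have := mh i; lia.
  - by move=> i; rewrite hE chain_gap // ltnW.
(* The factor q - 1 from [gain] times 1 + q + ... + q^(m-1) is q^m - 1, one less than the q^m by
   which the saving at the top is scaled. *)
have geo : (q ^ m).-1 * (vcost p l (s m) - vcost p l h) >= \sum_(t < m) q ^ t * S.
  by rewrite -big_distrl /= predn_exp [q.-1 * _]mulnC -mulnA leq_mul2l leS orbT.
have sum_low : q ^ m * chain_cost m u <= q ^ m * chain_cost m s + \sum_(t < m) q ^ t * S.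
  rewrite !big_distrr -big_split; apply: leq_sum => t _; exact: low.
have : q ^ m * (chain_cost m s + vcost p l (s m)) <= q ^ m * (chain_cost m u + vcost p l h).
  by rewrite leq_mul2l leC orbT.
have qm : 0 < q ^ m by rewrite !expn_gt0 (ltnW p_gt1).
rewrite -(subnK (ltnW lt)) !mulnDr.
set D := vcost _ _ (s m) - _ in geo *.
have : q ^ m * D = (q ^ m).-1 * D + D by rewrite -{1}(prednK qm) mulSn addnC.
have : 0 < D by rewrite subn_gt0.
lia.
Qed.

(** Replacing either top vector by their join v keeps a chain in the box, so v costs at least as
    much as each. By submodularity their meet k costs no more than either, and [top_strict_min]
    identifies both with k. The remainders are optimal below k - 1. *)
Lemma optimal_unique B n s s' : optimal_below B n s -> optimal_below B n s' ->
  forall t i, t < n -> s t i = s' t i.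
Proof.
elim: n B s s' => // m IHm B s s' os os' t i.
case: (os) (os') => ch bd opt [ch' bd' opt'].
pose k i := minn (s m i) (s' m i); pose v i := maxn (s m i) (s' m i).
have [f f'] : feasible p (s m) /\ feasible p (s' m).
  by case: ch ch' => f _ _ [f' _ _]; split; [apply: f | apply: f'].
have gts i' : m < s m i' by apply: chain_gt ch _.
have gts' i' : m < s' m i' by apply: chain_gt ch' _.
have fk : feasible p k := feasible_min f f'.
have fv : feasible p v := feasible_max f f'.
have le_v w : chain m.+1 w -> bounded B m.+1 w ->
    (forall u, chain m.+1 u -> bounded B m.+1 u -> chain_cost m.+1 w <= chain_cost m.+1 u) ->
    (forall i, w m i <= v i) -> vcost p l (w m) <= vcost p l v.
  move=> cw bw ow wv; rewrite -(leq_add2l (chain_cost m w)) -chain_costS.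
  rewrite -chain_cost_extend; apply: ow; last first.
    move=> t' i'; rewrite /extend; case: ifP => [t'm _|_ _]; first by rewrite bw // ltnW.
    by rewrite geq_max bd ?bd'.
  apply: chain_extend => // [|i'|t' i' t'm]; first exact: chainW.
    by rewrite /v leq_max (leq_ltn_trans _ (gts i')).
  by apply: leq_trans (wv i'); have := chain_gap i' cw (ltnW t'm); lia.
have lev : vcost p l (s m) <= vcost p l v by apply: le_v => // j; apply: leq_maxl.
have lev' : vcost p l (s' m) <= vcost p l v by apply: le_v => // j; apply: leq_maxr.
have sub : vcost p l v + vcost p l k <= vcost p l (s m) + vcost p l (s' m).
  exact: vcost_submod.
have ek j : k j = s m j.
  apply/eqP/negP => /negP ne.
  have := @top_strict_min B m s k os fk _ (ex_intro _ j ne).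
  have/[swap]/[apply] : forall i, m < k i <= s m i.
    by move=> j'; rewrite leq_min gts gts' geq_minl.
  by lia.
have ek' j : k j = s' m j.
  apply/eqP/negP => /negP ne.
  have := @top_strict_min B m s' k os' fk _ (ex_intro _ j ne).
  have/[swap]/[apply] : forall i, m < k i <= s' m i.
    by move=> j'; rewrite leq_min gts gts' geq_minr.
  by lia.
rewrite ltnS leq_eqVlt => /predU1P[->|tm]; first by rewrite -ek ek'.
have restrict w : optimal_below B m.+1 w -> (forall i, w m i = k i) ->
    optimal_below (fun i => (k i).-1) m w.
  move=> [cw bw ow] wk; split; first exact: chainW.
    by move=> t' i' t'm; have := chain_gap i' cw (ltnW t'm); rewrite wk; lia.
  move=> z cz bz; rewrite -(leq_add2r (vcost p l (w m))) -chain_costS.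
  rewrite -chain_cost_extend; apply: ow; last first.
    move=> t' i'; rewrite /extend; case: ifP => [t'm _|_ _]; last exact: bw.
    by apply: leq_trans (bz _ _ t'm) _; rewrite -wk (leq_trans (leq_pred _)) ?bw.
  have wpos i' : 0 < w m i' by case: cw => _ pos _; apply: pos.
  apply: chain_extend => // [|t' i' t'm]; first by case: cw => fw _ _; apply: fw.
  by have := bz t' i' t'm; have := wpos i'; rewrite wk; lia.
by apply: (IHm _ s s' (restrict s os _) (restrict s' os' _)).
Qed.

End Chains.

(** * Optimal chains without a box, and convexity of their cost *)

Section OptimalChains.
Variables (p b : nat).
Variable l : 'I_b -> nat -> nat.
Hypothesis p_gt1 : 1 < p.
Hypothesis lP : chip_weights p l.

Definition optimal (n : nat) (s : nat -> 'I_b -> nat) : Prop :=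
  chain p n s /\ forall u, chain p n u -> chain_cost p l n s <= chain_cost p l n u.

Lemma optimal_exists n : exists s, optimal n s.
Proof.
have [s cs smin] : exists2 s, chain p n s &
    forall u, chain p n u -> chain_cost p l n s <= chain_cost p l n u.
  apply: ex_min; exists (fun t _ => t.+1); split=> // t _ i.
  by rewrite -[X in X <= _]mul1n leq_mul2r (ltnW p_gt1) orbT.
by exists s.
Qed.

Lemma optimal_eq n s s' : optimal n s -> optimal n s' ->
  forall t i, t < n -> s t i = s' t i.
Proof.
(* Any box holding both chains turns optimality into [optimal_below]. *)
move=> [cs os] [cs' os']; pose B i := \sum_(t < n) (s t i + s' t i).
have bd t i : t < n -> s t i + s' t i <= B i.
  by move=> tn; rewrite /B (bigD1 (Ordinal tn)) //= leq_addr.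
apply: (@optimal_unique p b l p_gt1 lP B).
  split=> [//|t i tn|u cu _]; last exact: os.
  exact: leq_trans (leq_addr _ _) (bd t i tn).
split=> [//|t i tn|u cu _]; last exact: os'.
exact: leq_trans (leq_addl _ _) (bd t i tn).
Qed.

(* The shifted lattice operations s_t \/ r_(t-1) and s_(t+1) /\ r_t turn chains of
   lengths n+2 and n into two chains of length n+1. *)
Lemma optimal_cost_convex n r x s : 0 < b ->
    optimal n r -> optimal n.+1 x -> optimal n.+2 s ->
  2 * chain_cost p l n.+1 x < chain_cost p l n r + chain_cost p l n.+2 s.
Proof.
move=> b_gt0 [cr or] [cx ox] [cs os].
pose J t i := if t is t'.+1 then maxn (s t i) (r t' i) else s 0 i.
pose M t i := if t < n then minn (s t.+1 i) (r t i) else s t.+1 i.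
case: (cr) (cs) => fr rpos rincr [fs spos sincr].
have cJ : chain p n.+1 J.
  split=> [[|t] tn|[|t] i tn|[|t] i tn] /=.
  - exact: fs.
  - by apply: feasible_max; [apply: fs; apply: ltnW | apply: fr].
  - exact: spos.
  - by rewrite leq_max spos // ltnW.
  - by rewrite leq_max sincr // ltnW.
  - by rewrite gtn_max !leq_max sincr ?rincr ?orbT // ltnW.
have cM : chain p n.+1 M.
  rewrite /M; split=> [t tn|t i tn|t i tn].
  - case: (ltnP t n) => tn'; last exact: fs.
    by apply: feasible_min; [apply: fs | apply: fr].
  - by case: (ltnP t n) => tn'; rewrite ?leq_min ?spos ?rpos.
  - rewrite ltnS in tn; rewrite tn; case: (ltnP t.+1 n) => tn'.
      by rewrite leq_min !gtn_min sincr ?rincr ?orbT.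
    by rewrite gtn_min sincr.
have le0 : \sum_(t < n) vcost p l (fun i => maxn (s t.+1 i) (r t i)) +
    \sum_(t < n) vcost p l (fun i => minn (s t.+1 i) (r t i)) <=
    chain_cost p l n r + \sum_(t < n) vcost p l (s t.+1).
  rewrite [X in _ <= X]addnC /chain_cost -!big_split; apply: leq_sum => t _.
  by apply: vcost_submod => //; [apply: fs; rewrite ltnS ltnW // ltnS | apply: fr].
have le : chain_cost p l n.+1 J + chain_cost p l n.+1 M <=
    chain_cost p l n r + chain_cost p l n.+2 s.
  have -> : chain_cost p l n.+1 J = vcost p l (s 0) +
      \sum_(t < n) vcost p l (fun i => maxn (s t.+1 i) (r t i)).
    by rewrite /chain_cost big_ord_recl.
  have -> : chain_cost p l n.+1 M =
      \sum_(t < n) vcost p l (fun i => minn (s t.+1 i) (r t i)) + vcost p l (s n.+1).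
    rewrite chain_costS; congr (_ + _); last by rewrite /M ltnn.
    by apply: eq_bigr => t _; rewrite /M ltn_ord.
  have -> : chain_cost p l n.+2 s =
      vcost p l (s 0) + \sum_(t < n) vcost p l (s t.+1) + vcost p l (s n.+1).
    by rewrite chain_costS /chain_cost big_ord_recl.
  lia.
have leJ := ox J cJ; have leM := ox M cM.
(* Otherwise J and M are both optimal, hence equal. Starting from J_0 = s_0 this forces J_t = s_t
   for t <= n, while M_n = s_(n+1) > s_n. *)
rewrite ltnNge; apply/negP => ge.
have oJ : optimal n.+1 J by split=> // u cu; have := ox u cu; lia.
have oM : optimal n.+1 M by split=> // u cu; have := ox u cu; lia.
have eJM := optimal_eq oJ oM; pose i := Ordinal b_gt0.
have eJs t : t <= n -> J t i = s t i.
  elim: t => // t IHt tn; have lt := sincr t i (leqW tn).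
  have := eJM t i (leqW tn); rewrite IHt ?(ltnW tn) // /M tn /=; lia.
have := eJM n i (leqnn _); rewrite eJs // /M ltnn => e.
by have := sincr n i (leqnn _); rewrite e ltnn.
Qed.

End OptimalChains.

(** * Enriched permutations and chains *)

Section EnrichedPermutations.
Variables (p b : nat) (d : nat -> nat).
Variable l : 'I_b -> nat -> nat.
Hypothesis vpi_Psi : forall k1 k2 : 'I_b * nat, vpi (Psi p d k1 k2) =
  if (k2.1 == ord_pred k1.1) && (k2.2 <= p * k1.2)
  then Some (wsum l k1.1 (p * k1.2 - k2.2)) else None.

Local Notation J1 := ('I_b * nat)%type.
Implicit Type s : nat -> 'I_b -> nat.

Lemma big_oadd (T : eqType) (r : seq T) (F : T -> option nat) (f : T -> nat) :
  (forall k, k \in r -> F k = Some (f k)) ->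
  \big[oadd/Some 0]_(k <- r) F k = Some (\sum_(k <- r) f k).
Proof.
elim: r => [|k r IHr] FP; first by rewrite !big_nil.
by rewrite !big_cons FP ?mem_head // IHr // => k' k'r; rewrite FP // inE k'r orbT.
Qed.

Lemma big_oadd_Some (T : eqType) (r : seq T) (F : T -> option nat) v :
  \big[oadd/Some 0]_(k <- r) F k = Some v -> forall k, k \in r -> F k.
Proof.
elim: r v => [|k r IHr] v; first by [].
rewrite big_cons; case Ek: (F k) => [x|] //; case Er: (\big[_/_]_(_ <- _) _) => [y|] // _.
by move=> k'; rewrite inE => /predU1P[->|/(IHr _ Er)//]; rewrite Ek.
Qed.

Definition finite_at (sigma : J1 -> J1) (k : J1) :=
  ((sigma k).1 == ord_pred k.1) && ((sigma k).2 <= p * k.2).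

Definition entry_cost (sigma : J1 -> J1) (k : J1) :=
  wsum l k.1 (p * k.2 - (sigma k).2).

Lemma vsig_finite (S : {fset J1}) sigma : (forall k, k \in S -> finite_at sigma k) ->
  vsig p d S sigma = Some (\sum_(k <- S) entry_cost sigma k).
Proof.
by move=> fin; apply: big_oadd => k kS; rewrite vpi_Psi -/(finite_at _ _) fin.
Qed.

Lemma vsig_Some (S : {fset J1}) sigma v : vsig p d S sigma = Some v ->
  forall k, k \in S -> finite_at sigma k.
Proof.
move=> /big_oadd_Some fin k /fin; rewrite vpi_Psi -/(finite_at _ _).
by case: (finite_at sigma k).
Qed.

(** Dictionary between chains and order-preserving rotational permutations; [sigma] stays free off
    [S], as in [rot_eperm]. *)
Definition represents (n : nat) (s : nat -> 'I_b -> nat) (S : {fset J1})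
    (sigma : J1 -> J1) :=
  (forall i m, ((i, m) \in S) = (m \in mkseq (s^~ i) n)) /\
  (forall t i, t < n -> sigma (i, s t i) = (ord_pred i, s t (ord_pred i))).

Lemma chain_inj n s i : chain p n s -> {in gtn n &, injective (s^~ i)}.
Proof.
move=> [_ _ incr]; have mono t k : t + k.+1 < n -> s t i < s (t + k.+1) i.
  elim: k => [|k IHk]; first by rewrite addn1 => /incr.
  by rewrite addnS => tk; apply: ltn_trans (IHk (ltnW tk)) (incr _ _ tk).
move=> t t'; rewrite !inE => tn t'n e; apply/eqP; rewrite eqn_leq.
apply/andP; split; rewrite leqNgt; apply/negP => lt.
  by have := mono t' (t - t').-1; rewrite (_ : t' + _ = t) ?e ?ltnn => [/(_ tn)//|]; lia.
by have := mono t (t' - t).-1; rewrite (_ : t + _ = t') ?e ?ltnn => [/(_ t'n)//|]; lia.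
Qed.

Lemma uniq_chain n s i : chain p n s -> uniq (mkseq (s^~ i) n).
Proof. by move=> ch; apply/mkseq_uniqP/(chain_inj ch). Qed.

Definition nodes n (s : nat -> 'I_b -> nat) : seq J1 :=
  [seq (i, s t i) | i <- enum 'I_b, t <- iota 0 n].

Lemma mem_nodes n s i m : ((i, m) \in nodes n s) = (m \in mkseq (s^~ i) n).
Proof.
apply/allpairsPdep/mapP => [[i' [t [_ tn [-> ->]]]]|[t tn ->]]; first by exists t.
by exists i, t; rewrite mem_enum.
Qed.

Lemma perm_nodes n s S sigma : chain p n s -> represents n s S sigma ->
  perm_eq S (nodes n s).
Proof.
move=> ch [memS _]; apply: uniq_perm => [||[i m]]; last by rewrite mem_nodes -memS.
  exact: fset_uniq.
apply: allpairs_uniq_dep => [|i _|[i t] [i' t'] /=]; [exact: enum_uniq|exact: iota_uniq|].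
move=> /allpairsPdep[? [? [_ + [-> ->]]]] /allpairsPdep[? [? [_ + [-> ->]]]].
rewrite !mem_iota !add0n /= => tn t'n [ei es]; rewrite {}ei in es *.
by congr (Tagged _ _); apply: (chain_inj ch) es.
Qed.

Lemma sum_represents n s S sigma (F : J1 -> nat) : chain p n s ->
  represents n s S sigma -> \sum_(k <- S) F k = \sum_i \sum_(t < n) F (i, s t i).
Proof.
move=> ch rep; rewrite (perm_big _ (perm_nodes ch rep)) big_allpairs_dep /=.
by rewrite big_enum; apply: eq_bigr => i _; rewrite -{1}(subn0 n) -/(index_iota 0 n) big_mkord.
Qed.

Lemma card_represents n s S sigma : chain p n s -> represents n s S sigma ->
  #|` S| = b * n.
Proof.
move=> ch rep; rewrite (perm_size (perm_nodes ch rep)).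
by rewrite size_allpairs size_enum_ord size_iota.
Qed.

Lemma esize_represents n s S sigma : 0 < b -> chain p n s -> represents n s S sigma ->
  esize S = n.
Proof. by move=> b0 ch rep; rewrite /esize (card_represents ch rep) mulKn. Qed.

Lemma vsig_represents n s S sigma : chain p n s -> represents n s S sigma ->
  vsig p d S sigma = Some (chain_cost p l n s).
Proof.
move=> ch rep; have [memS sg] := rep; rewrite vsig_finite; last first.
  move=> [i m]; rewrite memS => /mapP[t]; rewrite mem_iota => /andP[_ tn] ->.
  by rewrite /finite_at sg // eqxx /=; case: ch => f _ _; apply: f.
congr Some; rewrite (sum_represents _ ch rep) exchange_big /=.
by apply: eq_bigr => t _; apply: eq_bigr => i _; rewrite /entry_cost sg.
Qed.

Lemma rot_represents n s S sigma : chain p n s -> represents n s S sigma ->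
  rot_eperm S sigma.
Proof.
move=> ch [memS sg].
have nodeP k : k \in S -> exists i, exists2 t, t < n & k = (i, s t i).
  case: k => i m; rewrite memS => /mapP[t]; rewrite mem_iota => /andP[_ tn] ->.
  by exists i, t.
split=> [k /nodeP[i [t tn ->]]|k /nodeP[i [t tn ->]]| |k /nodeP[i [t tn ->]]].
- by case: ch => _ pos _; apply: pos.
- by rewrite sg // memS map_f // mem_iota.
- move=> k k' /nodeP[i [t tn ->]] /nodeP[i' [t' t'n ->]].
  rewrite !sg // => e; have /ord_pred_inj ei := congr1 fst e; have es := congr1 snd e.
  by rewrite /= ei in es *; rewrite (chain_inj ch _ _ es).
- by rewrite sg //; apply/ord_pred_mod.
Qed.

Lemma represents_exists n s : chain p n s -> exists S sigma, represents n s S sigma.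
Proof.
move=> ch; exists (seq_fset tt (nodes n s)).
exists (fun k => (ord_pred k.1, s (index k.2 (mkseq (s^~ k.1) n)) (ord_pred k.1))).
split=> [i m|t i tn /=]; first by rewrite seq_fsetE mem_nodes.
by rewrite -{1}(nth_mkseq 0 (s^~ i) tn) index_uniq ?size_mkseq ?uniq_chain.
Qed.

Lemma represents_eq n s s' S S' sigma sigma' :
    (forall t i, t < n -> s' t i = s t i) ->
    represents n s S sigma -> represents n s' S' sigma' ->
  S' = S /\ {in S, forall k, sigma' k = sigma k}.
Proof.
move=> es [memS sg] [memS' sg']; split.
  apply/fsetP => -[i m]; rewrite memS memS'; congr (m \in _).
  by apply/eq_in_map => t; rewrite mem_iota => /andP[_ tn]; apply: es.
move=> [i m]; rewrite memS => /mapP[t]; rewrite mem_iota => /andP[_ tn] ->.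
by rewrite sg // -!es // sg'.
Qed.

Hypothesis p_gt1 : 1 < p.
Hypothesis lP : chip_weights p l.

(** Exchange argument: swapping the images of an inverted pair keeps all entries finite, and as p
    k.2 and p k'.2 differ by at least p, strict convexity lowers the cost. *)
Lemma monotone_minimizer n (S : {fset J1}) sigma v : is_minimizer p d n S sigma ->
    vsig p d S sigma = Some v ->
  forall k k', k \in S -> k' \in S -> k.1 = k'.1 -> k.2 < k'.2 ->
    (sigma k).2 < (sigma k').2.
Proof.
move=> [rot eS Smin] ev k k' kS k'S e1 lt2; rewrite ltnNge; apply/negP => le.
have fin := vsig_Some ev; case: (rot) => pos stab inj cls.
have /andP[/eqP c1 b1] := fin k kS; have /andP[/eqP c2 b2] := fin k' k'S.
have nek : k != k' by apply/eqP => e; rewrite e ltnn in lt2.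
have lt : (sigma k').2 < (sigma k).2.
  rewrite ltn_neqAle le andbT; apply/eqP => e; case/eqP: nek.
  by apply: inj => //; rewrite [LHS]surjective_pairing [RHS]surjective_pairing c1 c2 e1 e.
pose swap x := if x == k then k' else if x == k' then k else x.
have swapK : involutive swap.
  move=> x; rewrite /swap; have [->|xk] := eqVneq x k.
    by rewrite eqxx eq_sym (negPf nek).
  by have [->|xk'] := eqVneq x k'; rewrite ?eqxx // (negPf xk) (negPf xk').
have swapS x : x \in S -> swap x \in S.
  by move=> xS; rewrite /swap; case: ifP => // _; case: ifP.
pose tau x := sigma (swap x).
have tauk : tau k = sigma k' by rewrite /tau /swap eqxx.
have tauk' : tau k' = sigma k by rewrite /tau /swap eqxx eq_sym (negPf nek).
have taux x : x != k -> x != k' -> tau x = sigma x.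
  by rewrite /tau /swap => /negPf-> /negPf->.
have lep : p * k.2 <= p * k'.2 by rewrite leq_mul2l ltnW ?orbT.
have fint x : x \in S -> finite_at tau x.
  move=> xS; have [->|nk] := eqVneq x k.
    by rewrite /finite_at tauk c2 -e1 eqxx /=; lia.
  have [->|nk'] := eqVneq x k'; last by rewrite /finite_at taux //; apply: fin.
  by rewrite /finite_at tauk' c1 e1 eqxx (leq_trans b1 lep).
have rott : rot_eperm S tau.
  split=> // [x xS|x y xS yS|x xS].
  - exact/stab/swapS.
  - by move=> e; apply: (can_inj swapK); apply: inj e; apply: swapS.
  - by apply/ord_pred_mod/eqP; case/andP: (fint x xS).
have := Smin S tau rott eS; rewrite (vsig_finite fin) (vsig_finite fint) /=.
rewrite leqNgt => /negP; apply.
have k'Sk : k' \in (S `\ k)%fset by rewrite !inE eq_sym nek.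
rewrite !(big_fsetD1 k kS) /= !(big_fsetD1 k' k'Sk) /=.
rewrite [X in _ + (_ + X) < _](_ : _ =
    \sum_(x <- ((S `\ k) `\ k')%fset) entry_cost sigma x); last first.
  rewrite !big_seq; apply: eq_bigr => x; rewrite !inE => /and3P[xk' xk _].
  by rewrite /entry_cost taux.
rewrite !addnA ltn_add2r /entry_cost tauk tauk' -e1.
have pp : p * k.2 + p <= p * k'.2 by rewrite -mulnSr leq_mul2l lt2 orbT.
move: b1 b2 lt pp; move: (p * k.2) (p * k'.2) (sigma k).2 (sigma k').2 => x x' y y'.
by move=> *; apply: (wsum_convex_strict p_gt1 lP); lia.
Qed.

(** [sigma] embeds each class in its predecessor, so going round the cycle all classes have equal
    size. An increasing bijection then matches the sorted classes index by index, and the division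
    in [esize] is exact. *)
Lemma monotone_represents n (S : {fset J1}) sigma : 0 < b -> rot_eperm S sigma ->
    esize S = n -> (forall k, k \in S -> finite_at sigma k) ->
    (forall k k', k \in S -> k' \in S -> k.1 = k'.1 -> k.2 < k'.2 ->
       (sigma k).2 < (sigma k').2) ->
  exists2 s, chain p n s & represents n s S sigma.
Proof.
move=> b0 [pos stab inj cls] eS fin mono.
pose sl i := sort leq [seq k.2 | k <- S & k.1 == i].
have mem_sl i m : (m \in sl i) = ((i, m) \in S).
  rewrite mem_sort; apply/mapP/idP => [[[i' m']]|imS].
    by rewrite mem_filter /= => /andP[/eqP -> imS] ->.
  by exists (i, m); rewrite // mem_filter eqxx.
have uniq_sl i : uniq (sl i).
  rewrite sort_uniq map_inj_in_uniq ?filter_uniq ?fset_uniq // => -[i1 m1] [i2 m2] /=.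
  by rewrite !mem_filter /= => /andP[/eqP-> _] /andP[/eqP-> _] ->.
have sort_sl i : sorted ltn (sl i).
  by rewrite ltn_sorted_uniq_leq uniq_sl sort_sorted //; apply: leq_total.
pose f i m := (sigma (i, m)).2.
have fE i m : m \in sl i -> sigma (i, m) = (ord_pred i, f i m).
  rewrite mem_sl => /fin/andP[/eqP e _].
  by rewrite [LHS]surjective_pairing e.
have f_sub i : {subset map (f i) (sl i) <= sl (ord_pred i)}.
  by move=> _ /mapP[m mi ->]; rewrite mem_sl -fE // stab // -mem_sl.
have sort_f i : sorted ltn (map (f i) (sl i)).
  apply: (@homo_sorted_in _ _ (mem (sl i)) _ ltn) (allss _) (sort_sl i) => m m' mi m'i lt.
  by apply: mono; rewrite -?mem_sl.
have uniq_f i : uniq (map (f i) (sl i)).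
  by apply: sorted_uniq (sort_f i); [exact: ltn_trans | exact: ltnn].
have le_size i : size (sl i) <= size (sl (ord_pred i)).
  by rewrite -(size_map (f i)); apply: uniq_leq_size.
have eq_size := ord_pred_const le_size.
have f_map i : map (f i) (sl i) = sl (ord_pred i).
  apply: (irr_sorted_eq ltn_trans ltnn) => //.
  have [|_] := uniq_min_size (uniq_f i) (@f_sub i) => //.
  by rewrite size_map (eq_size _ i).
pose s t i := nth 0 (sl i) t; pose N := size (sl (Ordinal b0)).
have sN i : size (sl i) = N by apply: eq_size.
have memS t i : t < N -> (i, s t i) \in S by move=> tN; rewrite -mem_sl mem_nth ?sN.
have sig t i : t < N -> sigma (i, s t i) = (ord_pred i, s t (ord_pred i)).
  move=> tN; rewrite fE ?mem_sl ?memS //; congr (_, _).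
  by rewrite {2}/s -f_map (nth_map 0) ?sN.
have ch : chain p N s.
  split=> [t tN i|t i tN|t i tN].
  - by have := fin _ (memS t i tN); rewrite /finite_at sig // => /andP[].
  - exact: (pos _ (memS t i tN)).
  - by have /(sortedP 0)/(_ t) := sort_sl i; rewrite sN; apply.
have rep : represents N s S sigma.
  by split=> // i m; rewrite -mem_sl /mkseq -(sN i) -[sl i in LHS](mkseq_nth 0).
have eN : N = n by rewrite -eS (esize_represents b0 ch rep).
by exists s; rewrite -eN.
Qed.

End EnrichedPermutations.

(** * Valuations of the coefficients *)

Lemma vpi_eq (F : nzRingType) (f : nat -> F) v :
  f v != 0%R -> (forall m, m < v -> f m = 0%R) -> vpi f = Some v.
Proof.
move=> fv f0; rewrite /vpi; case: excluded_middle_informative => [ex|[]]; last by exists v.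
congr Some; case: ex_minnP => m fm mmin; apply/eqP; rewrite eqn_leq mmin // leqNgt.
by apply: contra fm => /f0 ->.
Qed.

Lemma vpi_zero (F : nzRingType) : vpi (fun=> 0%R : F) = None.
Proof.
by rewrite /vpi; case: excluded_middle_informative => // -[m]; rewrite eqxx.
Qed.

Lemma prime_ndvd_fact p n : prime p -> n < p -> ~~ (p %| n`!).
Proof.
move=> pp; elim: n => [|n IHn] np; first by rewrite fact0 gtnNdvd ?prime_gt1.
by rewrite factS Euclid_dvdM // negb_or IHn ?(ltnW np) // andbT gtnNdvd.
Qed.

Lemma bin_Fp_neq0 p n k : prime p -> n < p -> k <= n -> ('C(n, k)%:R != 0 :> 'F_p)%R.
Proof.
move=> pp np kn; rewrite -(GRing.dvdn_pcharf (pchar_Fp pp)).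
by apply: contra (prime_ndvd_fact pp np) => dv; rewrite -(bin_fact kn) dvdn_mulr.
Qed.

Lemma sum_digits_lt p (d : nat -> nat) e : (forall k, d k < p) ->
  \sum_(k < e) d k * p ^ k < p ^ e.
Proof.
move=> dp; elim: e => [|e IHe]; first by rewrite big_ord0.
rewrite big_ord_recr /= expnS; apply: (@leq_trans ((d e).+1 * p ^ e)).
  by rewrite mulSn -addSn leq_add2r.
by rewrite leq_mul2r dp orbT.
Qed.

Lemma sum_class_le b (i : 'I_b) (F : nat -> nat) J e :
  (forall j, j < J -> i + b * j < e) ->
  \sum_(j < J) F (i + b * j) <= \sum_(k < e | k %% b == i) F k.
Proof.
rewrite -!(big_mkord (fun k => k %% b == i) F).
elim: J e => [|J IHJ] e je; first by rewrite big_ord0.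
rewrite big_ord_recr /= (@big_cat_nat _ _ _ (i + b * J).+1) ?je //=.
apply: leq_trans (leq_addr _ _); rewrite [X in _ <= X]big_mkcond big_nat_recr //=.
have -> : (i + b * J) %% b = i by rewrite addnC mulnC modnMDl modn_small.
rewrite -big_mkcond eqxx leq_add2r; apply: IHJ => j jJ; rewrite ltn_add2l ltn_mul2l jJ andbT.
exact: leq_ltn_trans (ltn_ord i).
Qed.

Lemma sum_classes b (F : nat -> nat) e : 0 < b ->
  \sum_(i < b) \sum_(k < e | k %% b == i) F k = \sum_(k < e) F k.
Proof.
move=> b0; rewrite (exchange_big_dep xpredT) //=; apply: eq_bigr => k _.
by rewrite (big_pred1 (Ordinal (ltn_pmod k b0))).
Qed.

Lemma coef_binomial (F : fieldType) w y k :
  (((1 - ('X^w : {poly F})%:P * 'X) ^+ y)`_k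
   = ((-1) ^+ k * 'C(y, k)%:R) *: 'X^(w * k))%R.
Proof.
have -> : (1 - ('X^w : {poly F})%:P * 'X = (- 'X^w)%:P * 'X + 1)%R.
  by rewrite polyCN mulNr addrC.
rewrite exprD1n coef_sum.
have coefT i : ((((- 'X^w : {poly F})%:P * 'X) ^+ i *+ 'C(y, i))`_k =
    if k == i then (- 'X^w) ^+ i *+ 'C(y, i) else 0)%R.
  rewrite coefMn exprMn -polyC_exp coefCM coefXn.
  by case: eqP => _; rewrite ?mulr1 // mulr0 mul0rn.
under eq_bigr do rewrite coefT.
rewrite -big_mkcond /= -scalerA scaler_nat.
have -> : ((-1) ^+ k *: ('X^(w * k) *+ 'C(y, k)) =
    (- 'X^w) ^+ k *+ 'C(y, k) :> {poly F})%R.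
  rewrite [in RHS]exprNn -exprM -mulrnAr.
  by rewrite -[in LHS](signr_odd _ k) -[in RHS](signr_odd _ k) mulr_sign scaler_sign.
have [ky|yk] := ltnP k y.+1.
  by rewrite (big_pred1 (Ordinal ky)) // => i; rewrite -val_eqE eq_sym.
rewrite bin_small // mulr0n big_pred0 // => i; apply/eqP => e.
by have := ltn_ord i; rewrite -e ltnNge yk.
Qed.

(** * The exponents q^j p^i as chip weights *)

Section Chips.
Variables (p b : nat) (d : nat -> nat).
Hypothesis p_prime : prime p.
Hypothesis dp : forall k, d k < p.
Hypothesis full : qfull b d.

Let p_gt1 : 1 < p := prime_gt1 p_prime.

Definition digit_count (i : 'I_b) (J : nat) : nat := \sum_(j < J) d (i + b * j).

Lemma digit_countS i J : digit_count i J.+1 = digit_count i J + d (i + b * J).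
Proof. by rewrite /digit_count big_ord_recr. Qed.

Lemma digit_count_homo i J J' : J <= J' -> digit_count i J <= digit_count i J'.
Proof.
move=> /subnKC <-; elim: (J' - J) => [|k IHk]; first by rewrite addn0.
by rewrite addnS digit_countS (leq_trans IHk) ?leq_addr.
Qed.

Lemma digit_count_unbounded i t : exists J, t < digit_count i J.+1.
Proof.
elim: t => [|t [J tJ]].
  have [j [_ /eqP dj]] := full i 0; exists j.
  by rewrite digit_countS addn_gt0 [0 < d _]lt0n dj orbT.
have [j [Jj /eqP dj]] := full i J.+1; exists j; rewrite digit_countS -addn1.
rewrite leq_add ?(leq_trans tJ) ?digit_count_homo //.
by rewrite lt0n.
Qed.

(* The exponent j of the t-th smallest element q^j p^i of the multiset attached
   to the class [i]. *)
Definition level (i : 'I_b) (t : nat) : nat := ex_minn (digit_count_unbounded i t).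

Definition chip (i : 'I_b) (t : nat) : nat := p ^ (i + b * level i t).

Lemma level_bounds i t : digit_count i (level i t) <= t < digit_count i (level i t).+1.
Proof.
rewrite /level; case: ex_minnP => -[|J] tJ Jmin; rewrite tJ andbT.
  by rewrite /digit_count big_ord0.
by rewrite leqNgt; apply/negP => /Jmin; rewrite ltnn.
Qed.

Lemma level_eq i t J : digit_count i J <= t < digit_count i J.+1 -> level i t = J.
Proof.
move=> /andP[le lt]; have /andP[le' lt'] := level_bounds i t.
apply/eqP; rewrite eqn_leq; apply/andP; split; rewrite leqNgt; apply/negP.
  by move=> /(digit_count_homo i)/leq_trans/(_ le'); rewrite leqNgt lt.
by move=> /(digit_count_homo i)/leq_trans/(_ le); rewrite leqNgt lt'.
Qed.

(** This Galois connection turns comparisons of levels into comparisons of counts. *)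
Lemma level_lt i t J : (level i t < J) = (t < digit_count i J).
Proof.
have /andP[le' lt'] := level_bounds i t; apply/idP/idP => [lt|].
  exact: leq_trans lt' (digit_count_homo i lt).
apply: contraTT; rewrite -!leqNgt => le.
exact: leq_trans (digit_count_homo i le) le'.
Qed.

Lemma level_homo i t t' : t <= t' -> level i t <= level i t'.
Proof.
by move=> le; rewrite -ltnS level_lt (leq_ltn_trans le) // -level_lt.
Qed.

Lemma b_pos (i : 'I_b) : 0 < b. Proof. exact: leq_ltn_trans (ltn_ord i). Qed.

Lemma wsum_chip_count i J :
  wsum chip i (digit_count i J) = \sum_(j < J) d (i + b * j) * p ^ (i + b * j).
Proof.
elim: J => [|J IHJ]; first by rewrite /digit_count /wsum !big_ord0.
rewrite digit_countS wsumD IHJ [RHS]big_ord_recr /=; congr (_ + _).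
rewrite -[X in _ = X * _]card_ord -sum_nat_const; apply: eq_bigr => t _.
rewrite /chip (@level_eq _ _ J) // leq_addr digit_countS ltn_add2l //=.
Qed.

(** A digit is at most p - 1, so p - 1 further positions leave the current level. For the last
    clause, chips of different classes are distinct powers of p; if none reaches twice [l B x], all
    are smaller powers, and their total is below it by [sum_digits_lt]. *)
Lemma chip_weightsP : chip_weights p chip.
Proof.
have p0 : 0 < p by apply: ltnW.
split=> [i t|i t t' le|i t|B x K leK]; first by rewrite expn_gt0 p0.
- by rewrite leq_exp2l // leq_add2l leq_mul2l level_homo ?orbT.
- rewrite -expnD leq_exp2l // addnCA leq_add2l -mulnS leq_mul2l; apply/orP; right.
  rewrite ltnNge -ltnS level_lt -leqNgt digit_countS.
  have /andP[le _] := level_bounds i t; apply: leq_add => //.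
  by rewrite -ltnS prednK.
apply: NNPP => nex; move: leK; apply/negP; rewrite -ltnNge.
apply: leq_ltn_trans (sum_digits_lt (B + b * level B x) dp).
pose F k := d k * p ^ k; rewrite -(sum_classes F _ (b_pos B)).
rewrite [X in _ <= X](bigD1 B) //=; apply: leq_trans (leq_addl _ _).
apply: leq_sum => i neB; have [K0|Kpos] := posnP (K i).
  by rewrite K0 /wsum big_ord0.
have ltL : i + b * level i (K i).-1 < B + b * level B x.
  rewrite ltn_neqAle; apply/andP; split.
    apply/eqP => /(congr1 (modn^~ b)); rewrite ![_ + b * _]addnC ![b * _]mulnC.
    by rewrite !modnMDl !modn_small // => /val_inj e; rewrite e eqxx in neB.
  rewrite leqNgt; apply/negP => lt; apply: nex; exists i; split=> //.
  apply: (@leq_trans (p ^ (B + b * level B x).+1)); last by rewrite /chip leq_exp2l.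
  by rewrite /chip expnS leq_mul2r p_gt1 orbT.
apply: (@leq_trans (wsum chip i (digit_count i (level i (K i).-1).+1))).
  by apply: wsum_homo; rewrite -(prednK Kpos) -level_lt prednK.
rewrite wsum_chip_count; apply: (@sum_class_le b i F) => j jl.
by apply: leq_ltn_trans ltL; rewrite leq_add2l leq_mul2l -ltnS jl orbT.
Qed.

(** [beta_trunc] with its index shifted by one, so that induction starts from the empty product. *)
Definition beta_prod (i : 'I_b) (J : nat) : {poly {poly 'F_p}} :=
  (\prod_(j < J) (1 - (('X^((p ^ b) ^ j * p ^ i)%N : {poly 'F_p})%:P) * 'X)
     ^+ ydig d i j)%R.

(** This and the next two lemmas compare taking k exponents from level J with taking the n smallest:
    never better, worse if a lower level is left unexhausted, equal for the greedy k. *)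
Lemma wsum_tail_le i J n k : k <= n -> n <= digit_count i J.+1 ->
  wsum chip i n <= wsum chip i (n - k) + p ^ (i + b * J) * k.
Proof.
move=> kn nJ; rewrite -{1}(subnK kn) wsumD leq_add2l mulnC.
rewrite -[X in X * _]card_ord -sum_nat_const; apply: leq_sum => t _.
rewrite /chip leq_exp2l // leq_add2l leq_mul2l -ltnS level_lt; apply/orP; right.
by apply: leq_trans nJ; have := ltn_ord t; lia.
Qed.

Lemma wsum_tail_lt i J n k : 0 < k -> k <= n -> n <= digit_count i J.+1 ->
  n - k < digit_count i J -> wsum chip i n < wsum chip i (n - k) + p ^ (i + b * J) * k.
Proof.
case: k => // k _ kn nJ lt; apply: leq_ltn_trans (wsum_tail_le (ltnW kn) nJ) _.
have -> : n - k = (n - k.+1).+1 by lia.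
rewrite wsumS mulnSr addnA -!addnA ltn_add2l addnC ltn_add2l.
rewrite /chip ltn_exp2l // ltn_add2l ltn_mul2l level_lt lt andbT.
exact: leq_ltn_trans (ltn_ord i).
Qed.

Lemma wsum_tail_eq i J n k : n <= digit_count i J.+1 -> k = n - digit_count i J ->
  wsum chip i n = wsum chip i (n - k) + p ^ (i + b * J) * k.
Proof.
move=> nJ ->; have [le|/ltnW le] := leqP n (digit_count i J).
  by rewrite (eqP (le : n - _ == 0)) subn0 muln0 addn0.
rewrite subKn // -{1}(subnKC le) wsumD; congr (_ + _); rewrite mulnC.
rewrite -[X in _ = X * _]card_ord -sum_nat_const; apply: eq_bigr => t _.
rewrite /chip (@level_eq _ _ J) // leq_addr /=.
by apply: leq_trans nJ; have := ltn_ord t; lia.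
Qed.

(* Newton-polygon bookkeeping: the n-th theta-coefficient starts at the sum of the
   n smallest exponents, with coefficient a product of binomials prime to p. *)
Lemma beta_prod_coef i J n :
  [/\ forall m, m < wsum chip i n -> (((beta_prod i J)`_n)`_m = 0)%R,
      digit_count i J < n -> ((beta_prod i J)`_n = 0)%R
    & n <= digit_count i J -> (((beta_prod i J)`_n)`_(wsum chip i n) != 0)%R].
Proof.
elim: J n => [|J IHJ] n.
  rewrite /beta_prod /digit_count !big_ord0 coef1; split=> [m|n0|].
  - by case: n => [|n]; rewrite ?coef0 // /wsum big_ord0.
  - by case: n n0.
  - by rewrite leqn0 => /eqP ->; rewrite /wsum big_ord0 coef1 oner_neq0.
have ew : (p ^ b) ^ J * p ^ i = p ^ (i + b * J) by rewrite -expnM -expnD addnC.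
pose e k : 'F_p := ((-1) ^+ k * 'C(d (i + b * J), k)%:R)%R.
pose w := p ^ (i + b * J).
pose T k m := (e k * (if (m < w * k)%N then 0 else
  ((beta_prod i J)`_(n - k)%N)`_(m - w * k)%N))%R.
have coefE m : (((beta_prod i J.+1)`_n)`_m = \sum_(k < n.+1) T k m)%R.
  rewrite /beta_prod big_ord_recr /= coefMr coef_sum; apply: eq_bigr => k _.
  by rewrite coef_binomial ew -scalerAr coefZ coefMXn.
have e0 k : d (i + b * J) < k -> e k = 0%R by move=> lt; rewrite /e bin_small ?mulr0.
have T0 k m : k <= n -> m < wsum chip i (n - k) + w * k -> T k m = 0%R.
  move=> kn lt; rewrite /T; case: ltnP => le; first by rewrite mulr0.
  have lt' : m - w * k < wsum chip i (n - k) by lia.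
  by case: (IHJ (n - k)) => /(_ _ lt') -> _ _; rewrite mulr0.
have TJ k m : digit_count i J < n - k -> T k m = 0%R.
  move=> lt; rewrite /T; case: (IHJ (n - k)) => _ -> // _.
  by rewrite coef0; case: ifP; rewrite mulr0.
have big_n m : digit_count i J.+1 < n -> forall k, T k m = 0%R.
  rewrite digit_countS => lt k; have [le|lt'] := leqP k (d (i + b * J)).
    by apply: TJ; lia.
  by rewrite /T e0 ?mul0r.
split=> [m lt|lt|nJ].
- rewrite coefE big1 // => k _.
  have [nJ|lt'] := leqP n (digit_count i J.+1); last exact: big_n.
  have kn : k <= n by rewrite -ltnS.
  exact: T0 kn (leq_trans lt (wsum_tail_le kn nJ)).
- by apply/polyP => m; rewrite coefE coef0 big1 // => k _; apply: big_n.
(* Only k0 survives in lowest degree: a smaller k asks the earlier factors for more than their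
   theta-degree, a larger k gives a strictly higher power of pi. *)
rewrite coefE; set k0 := n - digit_count i J.
have k0n : k0 < n.+1 by rewrite ltnS leq_subr.
rewrite (bigD1 (Ordinal k0n)) //= big1 ?addr0 => [|k].
  rewrite /T (wsum_tail_eq nJ (erefl k0)) -/w ltnNge leq_addl addnK mulf_neq0 //.
    rewrite /e mulf_neq0 ?signr_eq0 //; apply: bin_Fp_neq0 => //.
    by move: nJ; rewrite digit_countS /k0; lia.
  by case: (IHJ (n - k0)) => _ _; apply; rewrite /k0; lia.
rewrite -val_eqE /= => nek; have [lt|ge] := ltnP k k0.
  by apply: TJ; rewrite /k0 in lt; lia.
have k0k : k0 < k by rewrite ltn_neqAle eq_sym nek.
apply: T0; first by rewrite -ltnS.
apply: wsum_tail_lt => //; first by apply: leq_ltn_trans k0k.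
  by rewrite -ltnS.
by have := ltn_ord k; rewrite /k0 in k0k; lia.
Qed.

(** The truncation used by [acoef] grows with the pi-degree. At degree [wsum chip i n] it contains
    all n smallest exponents, since j <= i + b j < p^(i + b j). *)
Lemma vpi_acoef i n : vpi (acoef p d i n) = Some (wsum chip i n).
Proof.
have accE m : acoef p d i n m = (((beta_prod i m.+1)`_n)`_m)%R by [].
apply: vpi_eq => [|m lt]; rewrite accE; last first.
  by case: (beta_prod_coef i m.+1 n) => coef0m _ _; apply: coef0m.
case: (beta_prod_coef i (wsum chip i n).+1 n) => _ _; apply.
case: n {accE} => // n; rewrite -level_lt ltnS wsumS.
apply: leq_trans (leq_addl _ _); rewrite /chip.
apply: leq_trans (ltnW (ltn_expl _ p_gt1)); apply: leq_trans (leq_addl _ _).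
by rewrite leq_pmull // (leq_ltn_trans _ (ltn_ord i)).
Qed.

Lemma vpi_Psi_chip (k1 k2 : 'I_b * nat) : vpi (Psi p d k1 k2) =
  if (k2.1 == ord_pred k1.1) && (k2.2 <= p * k1.2)
  then Some (wsum chip k1.1 (p * k1.2 - k2.2)) else None.
Proof.
rewrite /Psi (_ : (_ == _) = (k2.1 == ord_pred k1.1)); last first.
  by apply/eqP/eqP => /ord_pred_mod.
by case: ifP => _; [apply: vpi_acoef | apply: vpi_zero].
Qed.

End Chips.

(** * From optimal chains to minimizing permutations *)

Local Open Scope fset_scope.
Local Open Scope ring_scope.

Theorem theorem6p12 (p b : nat) (d : nat -> nat) :
  prime p -> (0 < b)%N -> (forall k, (d k < p)%N) -> qfull b d ->
  exists w : nat -> nat,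
    w 0%N = 0%N /\
    (forall n : nat, (1 <= n)%N ->
       exists (S : {fset ('I_b * nat)}) (sigma : 'I_b * nat -> 'I_b * nat),
         [/\ is_minimizer p d n S sigma,
             vsig p d S sigma = Some (w n) &
             forall (S' : {fset ('I_b * nat)}) (sigma' : 'I_b * nat -> 'I_b * nat),
               is_minimizer p d n S' sigma' ->
               S' = S /\ {in S, forall k, sigma' k = sigma k}]) /\
    (forall n : nat, (1 <= n)%N ->
       (w n)%:Z - (w n.-1)%:Z < (w n.+1)%:Z - (w n)%:Z).
Proof.
move=> p_prime b_gt0 dp full; have p_gt1 := prime_gt1 p_prime.
pose l := chip p full; have lP : chip_weights p l := chip_weightsP p_prime dp full.
have vP := vpi_Psi_chip p_prime dp full.
pose s n := proj1_sig (constructive_indefinite_description _ (optimal_exists l p_gt1 n)).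
have sP n : optimal p l n (s n) :=
  proj2_sig (constructive_indefinite_description _ (optimal_exists l p_gt1 n)).
exists (fun n => chain_cost p l n (s n)); split; first by rewrite /chain_cost big_ord0.
split=> [n n_gt0|[//|n] _] /=; last first.
  have := optimal_cost_convex p_gt1 lP b_gt0 (sP n) (sP n.+1) (sP n.+2).
  by lia.
have [S [sigma rep]] := represents_exists (sP n).1.
have rot := rot_represents (sP n).1 rep.
have eS := esize_represents b_gt0 (sP n).1 rep.
have ev := vsig_represents vP (sP n).1 rep.
(* Every minimizer of finite valuation comes from a chain. *)
have minP S' sigma' v : is_minimizer p d n S' sigma' -> vsig p d S' sigma' = Some v ->
    exists u, [/\ chain p n u, represents n u S' sigma' & v = chain_cost p l n u].
  move=> [rot' eS' min'] ev'.
  have mono := monotone_minimizer vP p_gt1 lP (And3 rot' eS' min') ev'.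
  have [u cu repu] := monotone_represents b_gt0 rot' eS' (vsig_Some vP ev') mono.
  by exists u; split=> //; move: ev'; rewrite (vsig_represents vP cu repu) => -[].
(* An arbitrary competitor need not be monotone. But a cheapest finite one exists, is a minimizer,
   and so comes from a chain, which costs at least as much as [s n]. *)
have lower (S' : {fset ('I_b * nat)}) sigma' v : rot_eperm S' sigma' -> esize S' = n ->
    vsig p d S' sigma' = Some v -> (chain_cost p l n (s n) <= v)%N.
  move=> rot' eS' ev'.
  pose P (x : {fset ('I_b * nat)} * ('I_b * nat -> 'I_b * nat)) :=
    [/\ rot_eperm x.1 x.2, esize x.1 = n & vsig p d x.1 x.2].
  pose f x := odflt 0%N (@vsig p b d x.1 x.2).
  have [|[S1 sigma1] [rot1 eS1 fin1] min1] := @ex_min _ P f.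
    by exists (S', sigma'); split; rewrite /= ?ev'.
  move: fin1; case E1: (vsig p d _ _) => [v1|//] _.
  have is_min1 : is_minimizer p d n S1 sigma1.
    split=> // S2 sigma2 rot2 eS2; rewrite E1; case E2: (vsig p d S2 sigma2) => [v2|//].
    have := min1 (S2, sigma2); rewrite /f /P /= E1 E2; apply.
    by split.
  have [u [cu _ e1]] := minP S1 sigma1 v1 is_min1 E1.
  apply: leq_trans ((sP n).2 u cu) _; rewrite -e1.
  have := min1 (S', sigma'); rewrite /f /P /= ev' E1.
  by apply.
exists S, sigma; split=> [||S' sigma' min'] //.
  split=> // S' sigma' rot' eS'; rewrite ev; case E': (vsig p d S' sigma') => [v|//].
  exact: lower E'.
(* A minimizer cannot have infinite valuation, since [S] with [sigma] has a finite one. *)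
case E': (vsig p d S' sigma') => [v|]; last first.
  by case: (min') => _ _ /(_ S sigma rot eS); rewrite E' ev.
have [u [cu repu ecost]] := minP S' sigma' v min' E'.
have le_u : (chain_cost p l n u <= chain_cost p l n (s n))%N.
  by case: (min') => _ _ /(_ S sigma rot eS); rewrite E' ev /= ecost.
have ou : optimal p l n u.
  by split=> // u' cu'; apply: leq_trans le_u ((sP n).2 u' cu').
by apply: represents_eq rep repu => t i tn; apply: (optimal_eq p_gt1 lP ou (sP n)).
Qed.
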